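(* Let $m,n\ge 0$ be integers with $(m,n)\neq(0,1)$, and let $\mathcal{O}$ be the family of outerplanar graphs. Then $\omega_{a(m,n)}(\mathcal{O})=\omega_{r(m,n)}(\mathcal{O})=3(2m+n)+1$.
   Context: An $(m,n)$-colored mixed graph has arcs colored with $m$ colors and edges colored with $n$ colors, with simple underlying undirected graph. A homomorphism $f:G\to H$ maps vertices to vertices so that every arc (resp. edge) $uv$ of color $c$ is sent to an arc (resp. edge) $f(u)f(v)$ of color $c$ (arcs keep direction). $\chi_{(m,n)}(G)$ is the minimum order of an $H$ with $G\to H$; $G$ is an $(m,n)$-clique if $\chi_{(m,n)}(G)=|V(G)|$. For an $(m,n)$-colored mixed graph $G$, $\omega_{a(m,n)}(G)$ is the maximum order of a subgraph of $G$ that is an $(m,n)$-clique; a relative $(m,n)$-clique of $G$ is a vertex set $R$ such that no two distinct vertices of $R$ have the same image under any homomorphism of $G$ to any $(m,n)$-colored mixed graph, and $\omega_{r(m,n)}(G)$ is the maximum size of a relative $(m,n)$-clique of $G$. For an undirected simple graph $G$, $\omega_{a(m,n)}(G)$ (resp. $\omega_{r(m,n)}(G)$) is the maximum of the corresponding parameter over all $(m,n)$-colored mixed graphs with underlying graph $G$, and for a family $\mathcal{F}$ of graphs it is the maximum over all $G\in\mathcal{F}$. *)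

(* Defs.v *)
From mathcomp Require Import all_boot all_order all_algebra.
From mathcomp Require Import all_classical all_reals all_analysis.
Set Implicit Arguments.
Unset Strict Implicit.
Unset Printing Implicit Defensive.
Import Order.TTheory GRing.Theory Num.Theory.
Import numFieldNormedType.Exports.
Local Open Scope classical_set_scope.
Local Open Scope ring_scope.

(* Both are total: the default value 0 is returned when [A] is empty or, for
   [nat_max], unbounded. *)
Definition nat_max (A : set nat) : nat :=
  xget 0%N [set k | A k /\ forall j, A j -> (j <= k)%N].

Definition nat_min (A : set nat) : nat :=
  xget 0%N [set k | A k /\ forall j, A j -> (k <= j)%N].

Record sgraph := SGraph {
  vertex :> finType;
  adj : rel vertex;
  adj_sym : symmetric adj;
  adj_irrefl : irreflexive adj }.

(* The last five fields say that the underlying undirected graph is simple: no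
   loops, and any two vertices are joined by at most one arc or edge, counting
   all colours and both directions. *)
Record cmgraph (m n : nat) (V : finType) := CMGraph {
  arc : 'I_m -> rel V;
  edge : 'I_n -> rel V;
  edge_sym : forall c, symmetric (edge c);
  edge_irrefl : forall c, irreflexive (edge c);
  arc_asym : forall c c' u v, arc c u v -> ~~ arc c' v u;
  arc_color_uniq : forall c c' u v, arc c u v -> arc c' u v -> c = c';
  edge_color_uniq : forall c c' u v, edge c u v -> edge c' u v -> c = c';
  arc_not_edge : forall c c' u v, arc c u v -> ~~ edge c' u v }.

Section ColoredMixedGraphs.
Variables (m n : nat).

Definition underlying_adj (V : finType) (G : cmgraph m n V) : rel V :=
  fun u v => [exists c, arc G c u v || arc G c v u] || [exists c, edge G c u v].

Definition is_hom (V W : finType) (G : cmgraph m n V) (H : cmgraph m n W)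
    (f : V -> W) : Prop :=
  (forall c u v, arc G c u v -> arc H c (f u) (f v)) /\
  (forall c u v, edge G c u v -> edge H c (f u) (f v)).

Definition chi (V : finType) (G : cmgraph m n V) : nat :=
  nat_min [set k | exists (W : finType) (H : cmgraph m n W) (f : V -> W),
                     is_hom G H f /\ #|W| = k].

Definition is_clique (V : finType) (G : cmgraph m n V) : Prop := chi G = #|V|.

(* A subgraph on the vertex set [S], not necessarily induced. *)
Definition is_subgraph (V : finType) (G : cmgraph m n V) (S : {set V})
    (H : cmgraph m n {x : V | x \in S}) : Prop := is_hom H G val.

Definition is_relative_clique (V : finType) (G : cmgraph m n V)
    (S : {set V}) : Prop :=
  forall (W : finType) (H : cmgraph m n W) (f : V -> W),
    is_hom G H f -> {in S &, injective f}.

Definition omega_a (V : finType) (G : cmgraph m n V) : nat :=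
  nat_max [set k | exists (S : {set V}) (H : cmgraph m n {x : V | x \in S}),
                     [/\ is_subgraph G H, is_clique H & #|S| = k]].

Definition omega_r (V : finType) (G : cmgraph m n V) : nat :=
  nat_max [set k | exists S : {set V}, is_relative_clique G S /\ #|S| = k].

Definition graph_omega_a (G : sgraph) : nat :=
  nat_max [set k | exists H : cmgraph m n G,
                     underlying_adj H =2 @adj G /\ omega_a H = k].

Definition graph_omega_r (G : sgraph) : nat :=
  nat_max [set k | exists H : cmgraph m n G,
                     underlying_adj H =2 @adj G /\ omega_r H = k].

Definition family_omega_a (F : sgraph -> Prop) : nat :=
  nat_max [set k | exists G : sgraph, F G /\ graph_omega_a G = k].

Definition family_omega_r (F : sgraph -> Prop) : nat :=
  nat_max [set k | exists G : sgraph, F G /\ graph_omega_r G = k].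

End ColoredMixedGraphs.

Section Outerplanarity.
Variable R : realType.
Local Notation plane := (R * R)%type.

Definition is_simple_arc (A : set plane) (a b : plane) : Prop :=
  exists g : R -> plane,
    [/\ {within `[0, 1], continuous g}, {in `[0, 1] &, injective g},
        g 0 = a, g 1 = b & g @` `[0, 1] = A].

(* A crossing-free drawing: [p] places the vertices and [ar u v] is the curve
   representing the edge [uv].  By the third clause, the points of [range p]
   in the fourth one are common ends of the two edges. *)
Definition is_plane_drawing (G : sgraph) (p : G -> plane)
    (ar : G -> G -> set plane) : Prop :=
  [/\ injective p,
      forall u v, adj u v -> ar u v = ar v u /\ is_simple_arc (ar u v) (p u) (p v),
      forall u v w, adj u v -> ar u v (p w) -> w = u \/ w = v
    & forall u v x y, adj u v -> adj x y ->
        ~ ((x = u /\ y = v) \/ (x = v /\ y = u)) ->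
        ar u v `&` ar x y `<=` range p].

Definition drawing_support (G : sgraph) (p : G -> plane)
    (ar : G -> G -> set plane) : set plane :=
  [set z | range p z \/ exists u v, adj u v /\ ar u v z].

Definition is_outer_face (D F : set plane) : Prop :=
  (exists2 z, (~` D) z & F = connected_component (~` D) z) /\ ~ bounded_set F.

(* Vertices belong to the drawing, hence not to a face, so lying in the closure
   of the outer face means lying on its boundary. *)
Definition outerplanar (G : sgraph) : Prop :=
  exists (p : G -> plane) (ar : G -> G -> set plane) (F : set plane),
    [/\ is_plane_drawing p ar, is_outer_face (drawing_support p ar) F
      & forall v, closure F (p v)].

End Outerplanarity.

(* Main.v *)
Require Import Defs.
From mathcomp Require Import all_boot all_order all_algebra.
From mathcomp Require Import all_classical all_reals all_analysis.
From mathcomp Require Import ring lra zify.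
From Stdlib Require Import Btauto.
Set Implicit Arguments.
Unset Strict Implicit.
Unset Printing Implicit Defensive.
Import Order.TTheory GRing.Theory Num.Theory.
Import numFieldNormedType.Exports.
Local Open Scope ring_scope.

(* Upper bound.  Place an apex in the outer face and join it to four vertices
   a, b, c, d: if each of the three pairings of these vertices were realised by
   two disjoint paths, K_5 would be drawn in the plane with disjoint
   independent edges.  This is impossible by a parity count of crossings, which
   works for edges that are arbitrary compact connected sets once these are
   replaced by fine chains of points.  So outerplanar graphs are "crossfree",
   and the rest is combinatorial.  A longest path shows that a crossfree graph
   with an edge has a vertex of degree 1 or 2; outside the clique such a vertex
   can be suppressed.  If it is a member v of the clique, with neighbours x and
   y, then every other member is x, y or adjacent to x or y, and either one
   vertex is adjacent to all other members or there are at most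
   7 <= 3 (2m + n) + 1 of them.  In the former case each of the 2m + n ways of
   being adjacent to the hub is shared by at most three members.

   Lower bound.  A hub joined to a path of 3 (2m + n) vertices, consecutive
   triples of the path using the same kind of spoke. *)

(** * Pairings by disjoint paths *)

(** Outerplanarity enters through paths rather than minors because a path is drawn as a compact
    connected set, to which a parity argument applies directly. Only the two paths of one pairing
    are disjoint; paths of different pairings may overlap. Hence the argument for K_5 has to allow
    edges with a common end to meet anywhere.

    Suppression creates edges that have no kind. So the induction carries not a coloured graph but a
    relation [e] together with a fixed labelling [t] of ordered pairs: two members are adjacent, or
    some common neighbour labels them differently. A suppressed vertex has at most two neighbours,
    so it accounts for at most one pair of members, and the new edge makes that pair adjacent.

    The number 7 is the bound itself when there are two kinds. A single kind occurs only for (0,1),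
    where no path of length two keeps its ends apart. *)

Section Walks.
Variables (V : finType) (e : rel V).
Implicit Types S T : pred V.

(** Walks may repeat vertices: only their vertex sets have to be disjoint. *)
Definition linked (a b c d : V) : Prop :=
  exists s t, [/\ path e a s, last a s = b, path e c t, last c t = d &
                  ~~ has (mem (a :: s)) (c :: t)].

(* This excludes both [K_4] and [K_{2,3}] as minors. *)
Definition crossfree : Prop := forall a b c d,
  linked a b c d -> linked a c b d -> linked a d b c -> False.

(** Confining walks to sets reduces the disjointness of two walks to that of two predicates. *)
Definition reach S (a b : V) : Prop :=
  exists s, [/\ path e a s, last a s = b & all S (a :: s)].

Lemma linked_reach S T a b c d : reach S a b -> reach T c d ->
  (forall v, S v -> T v -> False) -> linked a b c d.
Proof.
move=> [s [ps ls sS]] [t [pt lt tT]] ST; exists s, t; split => //.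
apply/hasPn => v vt; apply/negP => vs.
exact: ST (allP sS v vs) (allP tT v vt).
Qed.

Lemma reach_refl S a : S a -> reach S a a.
Proof. by move=> Sa; exists [::]; rewrite /= Sa. Qed.

Lemma reach_edge S a b : e a b -> S a -> S b -> reach S a b.
Proof. by move=> ab Sa Sb; exists [:: b]; rewrite /= ab Sa Sb. Qed.

Lemma reach_trans S b a c : reach S a b -> reach S b c -> reach S a c.
Proof.
move=> [s [ps <- sS]] [t [pt <- /= /andP[_ tS]]]; exists (s ++ t).
by rewrite cat_path ps pt last_cat -cat_cons all_cat sS tS.
Qed.

Lemma reach_sym S a b : symmetric e -> reach S a b -> reach S b a.
Proof.
move=> es [s [ps <- sS]]; exists (rev (belast a s)); split.
- by rewrite rev_path (eq_path (e' := e)) // => x y; rewrite es.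
- by case: (s) => //= x s'; rewrite rev_cons last_rcons.
- by rewrite -rev_rcons -lastI all_rev.
Qed.

Lemma reach_sub S T a b : subpred S T -> reach S a b -> reach T a b.
Proof. by move=> ST [s [ps ls sS]]; exists s; split => //; exact: sub_all sS. Qed.

End Walks.

(** * Longest paths and vertices of degree at most two *)

Section LongestPath.
Variables (V : finType) (e : rel V).
Hypotheses (e_sym : symmetric e) (e_irr : irreflexive e) (e_cross : crossfree e).

Lemma sorted_reach (s : seq V) x y : sorted e s -> x \in s -> y \in s ->
  reach e (mem s) x y.
Proof.
case: s => // a s ss.
suff H z : z \in a :: s -> reach e (mem (a :: s)) a z.
  by move=> /H/(reach_sym e_sym) xa /H; exact: reach_trans.
elim: s a ss z => [|b s IH] a /=.
  by move=> _ z /[1!inE] /eqP ->; apply: reach_refl; rewrite /= inE.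
move=> /andP[ab bs] z; rewrite inE => /orP[/eqP ->|zs].
  by apply: reach_refl; rewrite /= mem_head.
apply: (reach_trans (b := b)); first by apply: reach_edge; rewrite //= !inE eqxx ?orbT.
by apply: reach_sub (IH _ bs z zs) => v /= vs; rewrite inE vs orbT.
Qed.

(** A Pósa rotation: the chord [h k] enters the path in place of the edge [g k], which becomes a
    chord at the new head [g]. The vertices stay the same, so a longest path stays longest. *)
Lemma rotate_path h l g k r : sorted e (h :: rcons l g ++ k :: r) ->
  uniq (h :: rcons l g ++ k :: r) -> e h k ->
  [/\ sorted e (g :: rev l ++ h :: k :: r), uniq (g :: rev l ++ h :: k :: r),
      size (g :: rev l ++ h :: k :: r) = size (h :: rcons l g ++ k :: r) & e g k].
Proof.
move=> ss us hk.
have P : perm_eq (g :: rev l ++ h :: k :: r) (h :: rcons l g ++ k :: r).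
  apply/permP => q; rewrite /= !count_cat /= -cats1 count_cat count_rev /=; lia.
split; [|by rewrite (perm_uniq P)|exact: perm_size|].
  move: ss; rewrite /= cat_path => /andP[p1 /= /andP[gk p2]].
  have : path e (last h (rcons l g)) (rev (belast h (rcons l g))).
    by rewrite rev_path (eq_path (e' := e)) // => a b; rewrite e_sym.
  by rewrite last_rcons belast_rcons rev_cons -cat_rcons cat_path last_rcons /= hk p2 => ->.
by move: ss; rewrite /= cat_path last_rcons => /andP[_ /= /andP[]].
Qed.

Hypothesis deg3 : forall h k, e h k -> (2 < #|e h|)%N.

Lemma third_neighbour h a b : e h a -> exists k, [/\ e h k, k != a & k != b].
Proof.
move=> /deg3 d3.
have /subsetPn[k] : ~~ (e h \subset [set a; b]).
  apply/negP => /subset_leq_card; rewrite leqNgt (leq_ltn_trans _ d3)//.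
  by rewrite cards2; case: (_ != _).
by rewrite !inE negb_or => hk /andP[ka kb]; exists k.
Qed.

Variable M : nat.
Hypothesis longest : forall s, sorted e s -> uniq s -> (size s <= M)%N.

Lemma longest_neighbour h s v : sorted e (h :: s) -> uniq (h :: s) ->
  size (h :: s) = M -> e h v -> v \in s.
Proof.
move=> ss us sM hv; have [vs|vs] := boolP (v \in h :: s).
  by move: vs; rewrite inE => /orP[/eqP vh|//]; rewrite vh e_irr in hv.
suff : (size (v :: h :: s) <= M)%N by rewrite -sM ltnn.
by apply: longest; [rewrite /= e_sym hv|rewrite cons_uniq vs].
Qed.

(* The chord [h a] cuts off the initial segment [h :: l]; the edge [c b] keeps
   [b] attached to the rest.  A third neighbour of [h] beyond [a] would cross
   the chord, so it yields a chord cutting off a shorter segment. *)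
Lemma no_cut_segment n h l b a r c : (size l <= n)%N ->
  sorted e (h :: l ++ b :: a :: r) -> uniq (h :: l ++ b :: a :: r) ->
  size (h :: l ++ b :: a :: r) = M -> e h a -> c \in r -> e b c -> False.
Proof.
elim/ltn_ind: n h l b a r c => n IH h l b a r c ln ss us sM ha cr bc.
(* [head b l] is the successor of [h] on the path, so [h k] is a second chord. *)
have [k [hk ka kl]] := third_neighbour (head b l) ha.
have := longest_neighbour ss us sM hk.
rewrite -cat_rcons mem_cat inE (negPf ka) /= => /orP[krl|kr].
  have [l1 [l2 E]] : exists l1 l2, rcons l b = l1 ++ k :: l2.
    by case/splitPr: krl => l1 l2; exists l1, l2.
  case: (lastP l1) E => [E|l1' g E].
    by move/eqP: kl; case; move: E; case: (l) => [|x l'] [->].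
  have E' : l ++ [:: b, a & r] = rcons l1' g ++ k :: (l2 ++ a :: r).
    by rewrite -cat_rcons E -catA.
  rewrite E' in ss us sM; have [ss' us' ls' gk] := rotate_path ss us hk.
  have sl : (size l1' < size l)%N.
    move: (congr1 size E); rewrite size_cat !size_rcons /= addSn addnS => -[->].
    by rewrite ltnS leq_addr.
  (* After the rotation [h] ends the segment cut off by the chord [g k], and the old chord [h a]
     attaches it to the rest. *)
  apply: (IH (size l1') (leq_trans sl ln) g (rev l1') h k (l2 ++ a :: r) a) => //.
  - by rewrite size_rev.
  - by rewrite ls'.
  - by rewrite mem_cat mem_head orbT.
have eab : e a b.
  by move: ss; rewrite /= cat_path => /andP[_ /= /and3P[_]]; rewrite e_sym.
have phb : path e h (rcons l b).
  by move: ss; rewrite /= -cat_rcons cat_path => /andP[].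
have sar : sorted e (a :: r).
  by move: ss; rewrite /= -cat_rcons cat_path last_rcons => /andP[_ /= /andP[]].
have sr : sorted e r by exact: path_sorted sar.
have : uniq ((h :: rcons l b) ++ a :: r) by rewrite cat_cons cat_rcons.
rewrite cat_uniq => /and3P[uhb /hasPn N]; rewrite cons_uniq => /andP[ar ur].
have hNb : h != b by move: uhb; rewrite /= mem_rcons inE negb_or => /andP[/andP[]].
have hNa : h != a by have := N _ (mem_head a r); rewrite /= inE negb_or eq_sym => /andP[].
have bNa : b != a.
  have := N _ (mem_head a r); rewrite /= inE mem_rcons inE !negb_or => /and3P[_ ab _].
  by rewrite eq_sym.
have rN v : v \in r -> [/\ v != h, v != a & v != b].
  move=> vr; have := N v; rewrite inE vr orbT => /(_ isT).
  rewrite /= inE mem_rcons inE !negb_or => /and3P[-> -> _]; split => //.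
  by apply: contraNneq ar => <-.
have [kh _ kb] := rN _ kr.
(* The pairings: the chord [h a] against [b c] continued inside [r]; the two parts of the path,
   before and from [a] on; the edges [h k] and [a b]. *)
apply: (e_cross (a := h) (b := a) (c := b) (d := k)).
- apply: (linked_reach (S := mem [:: h; a]) (T := mem (b :: r))).
  + by apply: reach_edge; rewrite //= !inE eqxx ?orbT.
  + apply: (reach_trans (b := c)).
      by apply: reach_edge; rewrite //= !inE ?eqxx ?cr ?orbT.
    by apply: reach_sub (sorted_reach sr cr kr) => v /= vr; rewrite inE vr orbT.
  + move=> v /=; rewrite !inE => /orP[] /eqP -> /orP[/eqP E|/rN[]]; rewrite ?eqxx //.
      by rewrite E eqxx in hNb.
    by rewrite E eqxx in bNa.
- apply: (linked_reach (S := mem (h :: rcons l b)) (T := mem (a :: r))).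
  + by exists (rcons l b); rewrite last_rcons; split => //; apply/allP.
  + by apply: sorted_reach; rewrite // inE ?eqxx ?kr ?orbT.
  + by move=> v vh /N /negP.
- apply: (linked_reach (S := mem [:: h; k]) (T := mem [:: a; b])).
  + by apply: reach_edge; rewrite //= !inE eqxx ?orbT.
  + by apply: reach_edge; rewrite //= !inE eqxx ?orbT.
  + move=> v /=; rewrite !inE => /orP[] /eqP ->.
      by rewrite (negPf hNa) (negPf hNb).
    by case: (rN _ kr) => _ /negPf -> /negPf ->.
Qed.

End LongestPath.

Section LowDegreeVertex.
Variables (V : finType) (e : rel V).
Hypotheses (e_sym : symmetric e) (e_irr : irreflexive e) (e_cross : crossfree e).

(** Otherwise the head [h] of a longest path has two chords. Rotating at the nearer one, [h k], puts
    [h] just before [k], and the farther chord attaches [h] beyond [k], as [no_cut_segment]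
    forbids. *)
Lemma crossfree_low_degree u v : e u v -> exists h, (0 < #|e h| <= 2)%N.
Proof.
move=> uv; apply: contrapT => low.
have deg3 h k : e h k -> (2 < #|e h|)%N.
  move=> hk; rewrite ltnNge; apply/negP => le2; apply: low; exists h.
  by rewrite le2 andbT; apply/card_gt0P; exists k.
pose P n := [exists s : n.-tuple V, sorted e s && uniq s].
have Pmax n : P n -> (n <= #|V|)%N.
  move=> /existsP[s /andP[_ us]]; have := max_card (mem s).
  by rewrite (card_uniqP us) size_tuple.
have PI (s : seq V) : sorted e s -> uniq s -> P (size s).
  by move=> ss us; apply/existsP; exists (in_tuple s); rewrite ss us.
have P2 : P 2%N.
  apply: (PI [:: u; v]); rewrite /= ?uv // inE andbT.
  by apply: contraTneq uv => ->; rewrite e_irr.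
have [M PM longest'] := ex_maxnP (ex_intro P 2%N P2) Pmax.
have longest s : sorted e s -> uniq s -> (size s <= M)%N.
  by move=> ss us; exact/longest'/PI.
have M2 : (2 <= M)%N by exact: longest'.
have /existsP[[s /= /eqP sM] /andP[ss us]] := PM.
case: s sM ss us => [|h [|h1 s]] sM ss us; rewrite -?sM // in M2.
have hh1 : e h h1 by move: ss => /= /andP[].
have nb := longest_neighbour e_sym e_irr longest ss us sM.
have [k [hk kh1 _]] := third_neighbour deg3 h1 hh1.
have [c [hc ch1 ck]] := third_neighbour deg3 k hh1.
have F k' c' l1 l2 : h1 :: s = l1 ++ k' :: l2 -> c' \in l2 -> k' != h1 ->
    e h k' -> e h c' -> False.
  case: (lastP l1) => [|l g]; first by move=> [-> _] _ /eqP.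
  move=> E cl _ hk' hc'; rewrite E in ss us sM.
  have [ss' us' ls' gk] := rotate_path e_sym ss us hk'.
  apply: (no_cut_segment e_sym e_irr e_cross deg3 longest (leqnn (size (rev l))) ss' us'
    _ gk cl hc').
  by rewrite ls'.
have [l1 [l2 E]] : exists l1 l2, h1 :: s = l1 ++ k :: l2.
  by case/splitPr: (nb _ hk) => l1 l2; exists l1, l2.
have := nb _ hc; rewrite E mem_cat inE (negPf ck) /= => /orP[cl|cl].
  move: E; case/splitPr: cl => l3 l4; rewrite -catA /= => E.
  by apply: (F _ k _ _ E) => //; rewrite mem_cat mem_head orbT.
exact: F E cl kh1 hk hc.
Qed.

End LowDegreeVertex.

(** * Pairwise joined sets in crossfree graphs *)

Section JoinedSet.
Variables (V : finType) (e : rel V).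
Hypotheses (e_sym : symmetric e) (e_irr : irreflexive e) (e_cross : crossfree e).

Lemma edge_neq u v : e u v -> u != v.
Proof. by apply: contraTneq => ->; rewrite e_irr. Qed.

Definition avoids (s : seq V) : pred V := fun v => v \notin s.

Lemma reach2 (S : pred V) u z v : e z u -> e z v -> S u -> S z -> S v -> reach e S u v.
Proof.
move=> zu zv Su Sz Sv; apply: (reach_trans (b := z)); last exact: reach_edge.
by apply: reach_edge; rewrite // e_sym.
Qed.

(** Crossfreeness at a vertex with three neighbours: in each pairing of [x], [u], [v], [w] one half
    is an edge at [x]. *)
Lemma no_three_ways x u v w : e x u -> e x v -> e x w ->
  reach e (avoids [:: x; w]) u v -> reach e (avoids [:: x; v]) u w ->
  reach e (avoids [:: x; u]) v w -> False.
Proof.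
move=> xu xv xw uv uw vw.
have H a b c : e x a -> reach e (avoids [:: x; a]) b c -> linked e x a b c.
  move=> xa bc; apply: (linked_reach (S := mem [:: x; a])) bc _.
    by apply: reach_edge; rewrite //= !inE eqxx ?orbT.
  by move=> z /=; rewrite /avoids => ->.
by apply: (e_cross (a := x) (b := u) (c := v) (d := w)); apply: H.
Qed.

Definition joined_off x u v : Prop := e u v \/ exists z, [/\ z != x, e z u & e z v].

Lemma joined_off_reach x y u v : u \notin [:: x; y] -> v \notin [:: x; y] ->
  joined_off x u v ->
  reach e (avoids [:: x; y]) u v \/
  [/\ e y u, e y v, ~~ e u v & forall z, e z u -> e z v -> (z == x) || (z == y)].
Proof.
move=> uxy vxy; have [uv _|uv] := boolP (e u v); first by left; exact: reach_edge.
move=> [|[z [zx zu zv]]]; first by rewrite (negPf uv).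
have [|] := boolP [forall z, e z u ==> e z v ==> (z == x) || (z == y)]; last first.
  move=> /forallPn[{zx zu zv}z]; rewrite !negb_imply negb_or => /and4P[zu zv zx zy].
  by left; apply: (reach2 zu zv); rewrite //= /avoids !inE negb_or zx.
move=> /forallP H; right.
have N z' : e z' u -> e z' v -> (z' == x) || (z' == y).
  by move=> z'u z'v; move: (H z'); rewrite z'u z'v.
have zy : z = y by apply/eqP; have := N _ zu zv; rewrite (negPf zx).
by rewrite -zy in N *; split.
Qed.

(** By [no_three_ways], among any three members two are not adjacent and have the third as their
    only common neighbour besides [x]. A fourth member would have to be a second such middle for the
    same two. *)
Lemma joined_neighbours_card x (A : {set V}) :
  {in A, forall u, e x u} -> {in A &, forall u v, u != v -> joined_off x u v} ->
  (#|A| <= 3)%N.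
Proof.
move=> xA JA; rewrite leqNgt; apply/negP => A4.
pose M v u w := [/\ e v u, e v w, ~~ e u w & forall z, e z u -> e z w -> (z == x) || (z == v)].
have mid u v w : u \in A -> v \in A -> w \in A -> uniq [:: u; v; w] ->
    [\/ M v u w, M u v w | M w u v].
  move=> uA vA wA; rewrite /= !inE !negb_or andbT => /andP[/andP[uv uw] vw].
  have ne z : z \in A -> z != x by move=> /xA /edge_neq; rewrite eq_sym.
  have av a b : a \in A -> a != b -> a \notin [:: x; b].
    by move=> aA ab; rewrite !inE negb_or ne.
  have [vu wu wv] : [/\ v != u, w != u & w != v] by rewrite !(eq_sym w) (eq_sym v).
  have [r1|?] := joined_off_reach (av u v uA uv) (av w v wA wv) (JA u w uA wA uw);
    last exact: Or31.
  have [r2|?] := joined_off_reach (av v u vA vu) (av w u wA wu) (JA v w vA wA vw);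
    last exact: Or32.
  have [r3|?] := joined_off_reach (av u w uA uw) (av v w vA vw) (JA u v uA vA uv);
    last exact: Or33.
  by case: (no_three_ways (xA u uA) (xA v vA) (xA w wA) r3 r1 r2).
have bad a b c d : c \in A -> a \in A -> b \in A -> d \in A -> uniq [:: a; b; c; d] ->
    M b a c -> False.
  move=> cA aA bA dA /= /and4P[]; rewrite !inE !negb_or => /and3P[ab ac ad].
  move=> /andP[bc bd] cd _ [ba bc' Nac only].
  have : uniq [:: a; c; d] by rewrite /= !inE !negb_or ac ad cd.
  case/(mid _ _ _ aA cA dA) => -[].
  - by rewrite e_sym (negPf Nac).
  - by rewrite (negPf Nac).
  - move=> da dc _ _; have := only _ da dc.
    by rewrite eq_sym (negPf (edge_neq (xA _ dA))) eq_sym (negPf bd).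
have /card_geqP[s [us s4 sA]] := A4.
case: s us s4 sA => [|a [|b [|c [|d []]]]] // us _ sA.
have [aA bA cA dA] : [/\ a \in A, b \in A, c \in A & d \in A].
  by split; apply: sA; rewrite !inE eqxx ?orbT.
have uabc : uniq [:: a; b; c].
  by move: us; rewrite /= !inE !negb_or -!andbA => /and5P[-> -> _ ->].
have perm p q r : perm_eq [:: p; q; r] [:: a; b; c] -> uniq [:: p; q; r; d].
  move=> pqr; rewrite (@perm_uniq _ _ [:: a; b; c; d])//.
  by move: (perm_cat2r [:: d] [:: p; q; r] [:: a; b; c]); rewrite pqr.
case: (mid _ _ _ aA bA cA uabc) => H.
- exact: (bad _ _ _ _ cA aA bA dA us H).
- apply: (bad _ _ _ _ cA bA aA dA _ H); apply: perm.
  by rewrite (perm_catCA [:: b] [:: a] [:: c]).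
- apply: (bad _ _ _ _ bA aA cA dA _ H); apply: perm.
  by rewrite perm_cons (perm_catC [:: c] [:: b]).
Qed.

Variables (T : finType) (t : V -> V -> T) (Q : {set V}).
Hypothesis Q_joined : {in Q &, forall u v, u != v ->
  e u v \/ exists w, [/\ e w u, e w v & t w u != t w v]}.

Lemma dominated_card x : {in Q, forall u, u != x -> e x u} -> (#|Q| <= 3 * #|T| + 1)%N.
Proof.
move=> dom; rewrite (cardsD1 x) addnC leq_add ?leq_b1//.
have dom' u : u \in Q :\ x -> e x u by rewrite !inE => /andP[ux uQ]; exact: dom.
(* Members with the same label at [x] are not told apart by [x], so within a class they are joined
   off [x]. *)
rewrite -sum1_card (partition_big (t x) xpredT)//= mulnC -sum_nat_const.
apply: leq_sum => c _; rewrite sum1dep_card.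
apply: (@joined_neighbours_card x).
  by move=> u; rewrite inE => /andP[/dom'].
move=> u v; rewrite !inE => /andP[/andP[_ uQ] /eqP uc] /andP[/andP[_ vQ] /eqP vc] uv.
have [|[w [wu wv tw]]] := Q_joined uQ vQ uv; [by left|right; exists w; split => //].
by apply: contraNneq tw => ->; rewrite uc vc.
Qed.

(** * Members around a vertex with two neighbours *)

Section TwoNeighbours.
Variable v : V.

Definition private x y : {set V} :=
  [set u in Q | [&& u != v, u != x, u != y, e x u & ~~ e y u]].

Definition private_path a a' b := e a b \/ exists z, [/\ z != a', e z a & e z b].

Variables x y : V.
Hypotheses (vx : e v x) (vy : e v y) (vxy : forall u, e v u -> u = x \/ u = y).

(** The middle vertex is new: [x] is not adjacent to [b], [y] is not adjacent to [a], and [v] has no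
    neighbours besides [x] and [y]. *)
Lemma private_joined a b : a \in private x y -> b \in private y x ->
  e a b \/ exists z, [/\ z != x, z != y, z != v, e z a & e z b].
Proof.
rewrite !inE => /andP[aQ /and5P[av ax ay xa ya]] /andP[bQ /and5P[bv bb' bx yb xb]].
have ab : a != b by apply: contraNneq ya => ->.
have [|[z [za zb _]]] := Q_joined aQ bQ ab; first by left.
right; exists z; split => //.
- by apply: contraNneq xb => <-.
- by apply: contraNneq ya => <-.
- apply/eqP => zv; rewrite zv in za.
  by have [E|E] := vxy za; move: ax ay; rewrite E eqxx.
Qed.

(** [no_three_ways] at [x] for the neighbours [v], [a1], [a2], all connected through [b]; [v] gets
    there by way of [y]. *)
Lemma private_path_excl a1 a2 b : a1 \in private x y -> a2 \in private x y ->
  b \in private y x -> a1 != a2 -> private_path a1 a2 b -> private_path a2 a1 b -> False.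
Proof.
rewrite !inE => /andP[_ /and5P[a1v a1x a1y xa1 ya1]].
move=> /andP[_ /and5P[a2v a2x a2y xa2 ya2]] /andP[_ /and5P[bv bb' bx yb xb]] a12 P1 P2.
have xy : x != y by apply: contraNneq xb => ->.
have vNx := edge_neq vx; have vNy := edge_neq vy.
have [b1 b2] : b != a1 /\ b != a2.
  by split; [apply: contraNneq ya1 => <-|apply: contraNneq ya2 => <-].
have R a a' (S : pred V) : private_path a a' b -> S a -> S b ->
    (forall z, z != a' -> e z a -> e z b -> S z) -> reach e S b a.
  move=> P Sa Sb H; apply: reach_sym => //; case: P => [ab|[z [za' za zb]]].
    exact: reach_edge.
  by apply: (reach2 za zb) => //; exact: H.
have zx z : e z b -> z != x by move=> zb; apply: contraNneq xb => <-.
have zv z : e z b -> z != v.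
  move=> zb; apply/eqP => E; rewrite E in zb.
  by have [E'|E'] := vxy zb; move: bb' bx; rewrite E' eqxx.
have vR a a' : private_path a a' b -> a != x -> a != a' -> b != a' -> v != a' -> y != a' ->
    reach e (avoids [:: x; a']) v a.
  move=> P ax aa' ba' va' ya'.
  apply: (reach_trans (b := y)).
    by apply: reach_edge; rewrite //= /avoids !inE negb_or ?vNx ?va' // eq_sym xy.
  apply: (reach_trans (b := b)).
    by apply: reach_edge; rewrite //= /avoids !inE negb_or ?bx ?ba' // eq_sym xy.
  apply: (R _ _ _ P); rewrite /= /avoids ?inE ?negb_or ?ax ?bx //.
  by move=> z za' _ /zx; rewrite inE inE negb_or => ->.
have vx' : e x v by rewrite e_sym.
apply: (no_three_ways vx' xa1 xa2).
- by apply: (vR _ _ P1); rewrite // eq_sym.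
- by apply: (vR _ _ P2); rewrite // eq_sym.
- apply: (reach_trans (b := b)); first apply: reach_sym => //.
    apply: (R _ _ _ P1); rewrite /= /avoids ?inE ?negb_or ?a1x ?bx //.
    by move=> z _ _ zb; rewrite !inE negb_or zx// zv.
  apply: (R _ _ _ P2); rewrite /= /avoids ?inE ?negb_or ?a2x ?bx //.
  by move=> z _ _ zb; rewrite !inE negb_or zx// zv.
Qed.

(* If the first alternative fails, [a] reaches [b] only through [a']. *)
Lemma private_pathP a a' b : a \in private x y -> b \in private y x ->
  private_path a a' b \/ [/\ e a' a, e a' b & ~~ e a b].
Proof.
move=> A B; have [ab|[z [_ _ _ za zb]]] := private_joined A B; first by left; left.
have [za'|za'] := eqVneq z a'; last by left; right; exists z.
have [ab|ab] := boolP (e a b); first by left; left.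
by right; rewrite -za'.
Qed.

(** Of two members, one, [p], reaches [b] only through the other, [q]. Then [p] is not adjacent to
    [b], so it does not block a third member [r], while [q] leads [p] to [b] past [r]:
    [private_path_excl] applies to [p] and [r]. *)
Lemma private_card b : b \in private y x -> (#|private x y| <= 2)%N.
Proof.
move=> B; rewrite leqNgt; apply/negP => /card_geqP[s [us s3 sA]].
case: s us s3 sA => [|a1 [|a2 [|a3 []]]] //= us _ sA.
have [A1 A2 A3] : [/\ a1 \in private x y, a2 \in private x y & a3 \in private x y].
  by split; apply: sA; rewrite !inE eqxx ?orbT.
have [a12 a13 a23] : [/\ a1 != a2, a1 != a3 & a2 != a3].
  by move: us; rewrite !inE negb_or => /and3P[/andP[-> ->] ->].
have key p q r : p \in private x y -> r \in private x y ->
    p != r -> q != r -> e q p -> e q b -> ~~ e p b -> False.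
  move=> Ap Ar pr qr qp qb pb.
  have [P|[_ pb' _]] := private_pathP p Ar B; last by rewrite pb' in pb.
  by apply: (private_path_excl Ap Ar B pr _ P); right; exists q.
have [P1|[qp qb pb]] := private_pathP a2 A1 B; last exact: key A1 A3 a13 a23 qp qb pb.
have [P2|[qp qb pb]] := private_pathP a1 A2 B; last exact: key A2 A3 a23 a13 qp qb pb.
exact: private_path_excl A1 A2 B a12 P1 P2.
Qed.

Lemma private_pair a1 a2 b1 : a1 \in private x y -> a2 \in private x y ->
  a1 != a2 -> b1 \in private y x ->
  exists a a', [/\ a \in private x y, e a' a, e a' b1 & ~~ e a b1] /\
    a' \in private x y.
Proof.
move=> A1 A2 a12 B.
have [P1|[? ? ?]] := private_pathP a2 A1 B; last by exists a1, a2.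
have [P2|[? ? ?]] := private_pathP a1 A2 B; last by exists a2, a1.
by case: (private_path_excl A1 A2 B a12 P1 P2).
Qed.

End TwoNeighbours.

(** In the chain [a], [a'], [b1] of [private_pair], [b1] is not adjacent to [a] and so does not
    block [b2] from [a]; [b1] itself reaches [a] through [a']. This is the excluded situation with
    the two sides exchanged. *)
Lemma private_not_two v x y : v \in Q -> e v x -> e v y ->
  (forall u, e v u -> u = x \/ u = y) ->
  (1 < #|private v x y|)%N -> (1 < #|private v y x|)%N -> False.
Proof.
move=> vQ vx vy vxy /card_gt1P[a1 [a2 [A1 A2 a12]]] /card_gt1P[b1 [b2 [B1 B2 b12]]].
have vyx u : e v u -> u = y \/ u = x by move=> /vxy[]; auto.
have [a [a' [[A a'a a'b ab] A']]] := private_pair vx vy vxy A1 A2 a12 B1.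
have b1a : ~~ e b1 a by rewrite e_sym.
have [P|[_ ]] := private_pathP vyx b1 B2 A; last by rewrite e_sym (negPf ab).
apply: (private_path_excl vy vx vyx B1 B2 A b12 _ P); right; exists a'; split => //.
move: A' B2; rewrite !inE => /andP[_ /and5P[_ _ _ xa' _]] /andP[_ /and5P[_ _ _ _ xb2]].
by apply: contraNneq xb2 => <-.
Qed.

(** The member [y] takes the part of [b]: each private vertex is joined to [y] through a middle
    vertex, which is adjacent to [y] and hence not itself private. *)
Lemma private_alone v x y : v \in Q -> e v x -> e v y -> x != y ->
  (forall u, e v u -> u = x \/ u = y) ->
  y \in Q -> ~~ e x y -> (#|private v x y| <= 1)%N.
Proof.
move=> vQ vx vy xy vxy yQ xNy.
rewrite leqNgt; apply/negP => /card_gt1P[a1 [a2 [+ + a12]]].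
rewrite !inE => /andP[a1Q /and5P[a1v a1x a1y xa1 ya1]].
move=> /andP[a2Q /and5P[a2v a2x a2y xa2 ya2]].
have J a : a \in Q -> a != x -> a != y -> e x a -> ~~ e y a ->
    exists z, [/\ z != x, z != v, e z a, e z y & forall c, ~~ e y c -> z != c].
  move=> aQ ax ay xa ya; have [|[z [za zy _]]] := Q_joined aQ yQ ay.
    by rewrite e_sym (negPf ya).
  exists z; split => //.
  - by apply: contraNneq xNy => <-.
  - by apply/eqP => zv; rewrite zv in za; have [E|E] := vxy _ za; move: ax ay; rewrite E eqxx.
  - by move=> c yc; apply: contraNneq yc => <-; rewrite e_sym.
have [z1 [z1x z1v z1a z1y z1c]] := J _ a1Q a1x a1y xa1 ya1.
have [z2 [z2x z2v z2a z2y z2c]] := J _ a2Q a2x a2y xa2 ya2.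
have vx' : e x v by rewrite e_sym.
have vNx := edge_neq vx; have vNy := edge_neq vy.
have vR a a' z : a != x -> a != a' -> v != a' -> y != a' -> z != x -> z != a' ->
    e z a -> e z y -> reach e (avoids [:: x; a']) v a.
  move=> ax aa' va' ya' zx za' za zy.
  apply: (reach_trans (b := y)).
    by apply: reach_edge; rewrite //= /avoids !inE negb_or ?vNx ?va' // eq_sym xy.
  by apply: (reach2 zy za); rewrite /= /avoids !inE negb_or ?zx ?ax // eq_sym xy.
apply: (no_three_ways vx' xa1 xa2).
- by apply: (vR _ _ _ _ _ _ _ _ _ z1a z1y) => //; rewrite ?z1c // eq_sym.
- by apply: (vR _ _ _ _ _ _ _ _ _ z2a z2y) => //; rewrite ?z2c // eq_sym.
- apply: (reach_trans (b := y)).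
    by apply: (reach2 z1a z1y); rewrite /= /avoids !inE negb_or ?z1x ?a1x // eq_sym ?xy // eq_sym.
  by apply: (reach2 z2y z2a); rewrite /= /avoids !inE negb_or ?z2x ?a2x // eq_sym ?xy // eq_sym.
Qed.

End JoinedSet.

Section LowDegreeMember.
Variables (V : finType) (T : finType) (t : V -> V -> T) (Q : {set V}).
Hypothesis T2 : (2 <= #|T|)%N.

(** [t] is fixed while [e] varies, since suppression changes only the adjacency. *)
Definition pairwise_joined (e : rel V) : Prop :=
  {in Q &, forall u v, u != v ->
    e u v \/ exists w, [/\ e w u, e w v & t w u != t w v]}.

Lemma low_degree_bound (e : rel V) v : symmetric e -> irreflexive e -> crossfree e ->
  pairwise_joined e -> v \in Q -> (#|e v| <= 2)%N -> (#|Q| <= 3 * #|T| + 1)%N.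
Proof.
move=> e_sym e_irr e_cross QJ vQ d2.
have [noN|[x vx]] : (forall u, ~~ e v u) \/ exists x, e v x.
  have [/existsP[x vx]|/existsPn] := boolP [exists x, e v x]; first by right; exists x.
  by left.
  apply: (dominated_card e_sym e_irr e_cross QJ (x := v)) => u uQ uv.
  have [|[z [zu zv _]]] := QJ _ _ uQ vQ uv; first by rewrite e_sym.
  by have := noN z; rewrite e_sym zv.
have [y [vy vxy]] : exists y, e v y /\ forall u, e v u -> u = x \/ u = y.
  have [/existsP[y /andP[vy yx]]|/existsPn nx] := boolP [exists y, e v y && (y != x)].
    exists y; split => // u vu; have [->|ux] := eqVneq u x; first by left.
    have [->|uy] := eqVneq u y; first by right.
    move: d2; rewrite leqNgt => /negP[]; apply/card_gt2P.
    by exists x, y, u; do !split; rewrite // eq_sym.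
  (* In degree one [y] repeats [x]; this case ends below, since [x] is then adjacent to all members
     but itself. *)
  exists x; split => // u vu; left; apply/eqP.
  by have := nx u; rewrite vu negbK.
have vyx u : e v u -> u = y \/ u = x by move=> /vxy[]; auto.
have near u : u \in Q -> u != v -> [\/ u = x, u = y, e x u | e y u].
  move=> uQ uv; have vu : v != u by rewrite eq_sym.
  have [/vxy[]|[z [+ zu _]]] := QJ _ _ vQ uQ vu; [by constructor|by constructor 2|].
  by rewrite e_sym => /vxy[E|E]; [constructor 3|constructor 4]; rewrite -E.
have [|] := boolP [forall u, (u \in Q) ==> (u != x) ==> e x u].
  move=> /forallP H; apply: (dominated_card e_sym e_irr e_cross QJ (x := x)) => u uQ ux.
  by move: (H u); rewrite uQ ux.
move=> /forallPn[ux]; rewrite !negb_imply => /and3P[uxQ uxx xux].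
have [|] := boolP [forall u, (u \in Q) ==> (u != y) ==> e y u].
  move=> /forallP H; apply: (dominated_card e_sym e_irr e_cross QJ (x := y)) => u uQ uy.
  by move: (H u); rewrite uQ uy.
move=> /forallPn[uy]; rewrite !negb_imply => /and3P[uyQ uyy yuy].
have uxv : ux != v by apply: contraNneq xux => ->; rewrite e_sym.
have uyv : uy != v by apply: contraNneq yuy => ->; rewrite e_sym.
have [xy|xy] := eqVneq x y.
  have [E|E|E|E] := near _ uxQ uxv.
  - by rewrite E eqxx in uxx.
  - by rewrite E xy eqxx in uxx.
  - by rewrite E in xux.
  - by rewrite xy E in xux.
pose A := private e Q v x y; pose B := private e Q v y x.
pose W := [set u in Q | [&& u != v, e x u & e y u]].
have QU : Q \subset [set v; x; y] :|: (A :|: B :|: W).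
  apply/fintype.subsetP => u uQ; rewrite !inE uQ /=.
  have [->//|uv] := eqVneq u v; have [->//|nux] := eqVneq u x.
  have [->//|nuy] := eqVneq u y; rewrite /=.
  case: (near u uQ uv) => [/eqP|/eqP|->|->]; rewrite ?(negPf nux) ?(negPf nuy) //=.
    by case: (e y u).
  by case: (e x u).
have cardQ : (#|Q| <= 3 + (#|A| + #|B| + #|W|))%N.
  apply: leq_trans (subset_leq_card QU) _; apply: leq_trans (leq_card_setU _ _) _.
  apply: leq_add.
    apply: leq_trans (leq_card_setU _ _) _; rewrite cards1 addn1 ltnS.
    by rewrite cards2; case: (_ != _).
  apply: leq_trans (leq_card_setU _ _) _; rewrite leq_add2r.
  exact: leq_card_setU.
have W1 : (#|W| <= 1)%N.
  (* [v], [w1] and [w2] would form a [K_{2,3}] with [x] and [y]. *)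
  rewrite leqNgt; apply/negP => /card_gt1P[w1 [w2 [+ + w12]]].
  rewrite !inE => /andP[_ /and3P[w1v xw1 yw1]] /andP[_ /and3P[w2v xw2 yw2]].
  have [vNx vNy] := (edge_neq e_irr vx, edge_neq e_irr vy).
  have [xNw1 yNw1] := (edge_neq e_irr xw1, edge_neq e_irr yw1).
  have [xNw2 yNw2] := (edge_neq e_irr xw2, edge_neq e_irr yw2).
  have [vx' vy'] : e x v /\ e y v by rewrite !(e_sym _ v).
  apply: (no_three_ways e_cross vx' xw1 xw2).
  - by apply: (reach2 e_sym vy' yw1); rewrite /= /avoids !inE negb_or
      ?vNx ?xy ?w12 ?yNw2 1?eq_sym ?vNx ?xy ?xNw1 ?w2v // eq_sym.
  - by apply: (reach2 e_sym vy' yw2); rewrite /= /avoids !inE negb_or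
      ?vNx ?xy ?w12 ?yNw1 1?eq_sym ?vNx ?xy ?xNw2 ?w1v // eq_sym.
  - by apply: (reach2 e_sym yw1 yw2); rewrite /= /avoids !inE negb_or
      ?w1v ?w2v ?andbT 1?eq_sym ?xy // eq_sym.
(* The member [ux], missed by [x], lies in [B] unless it is [y]; so if [B] is empty, [y] is a member
   not adjacent to [x]. *)
have onlyB : #|B| = 0%N -> (#|A| <= 1)%N.
  move=> /cards0_eq B0; have uB : ux \notin B by rewrite B0 inE.
  have E : ux = y.
    apply/eqP; apply: contraNT uB => nuy; rewrite inE uxQ uxv nuy uxx xux /= andbT.
    by have [/eqP|/eqP|E|//] := near _ uxQ uxv; rewrite ?(negPf uxx) ?(negPf nuy) // E in xux *.
  by apply: (private_alone e_sym e_irr e_cross QJ vQ vx vy xy vxy); rewrite -E.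
have yx : y != x by rewrite eq_sym.
have onlyA : #|A| = 0%N -> (#|B| <= 1)%N.
  move=> /cards0_eq A0; have uA : uy \notin A by rewrite A0 inE.
  have E : uy = x.
    apply/eqP; apply: contraNT uA => nux; rewrite inE uyQ uyv nux uyy yuy /= andbT.
    by have [/eqP|/eqP|//|E] := near _ uyQ uyv; rewrite ?(negPf uyy) ?(negPf nux) // E in yuy *.
  by apply: (private_alone e_sym e_irr e_cross QJ vQ vy vx yx vyx); rewrite -E.
have A2 : (0 < #|B|)%N -> (#|A| <= 2)%N.
  by move=> /card_gt0P[b]; exact: (private_card e_sym e_irr e_cross QJ vx vy vxy).
have B2 : (0 < #|A|)%N -> (#|B| <= 2)%N.
  by move=> /card_gt0P[b]; exact: (private_card e_sym e_irr e_cross QJ vy vx vyx).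
have AB : (1 < #|A|)%N -> (1 < #|B|)%N -> False.
  exact: (private_not_two e_sym e_irr e_cross QJ vQ vx vy vxy).
(* Together [A] and [B] have at most 3 elements, so [Q] has at most 3 + 3 + 1 = 7, and [T2] gives 7
   <= 3 * #|T| + 1. *)
by move: cardQ W1 onlyA onlyB A2 B2 AB T2; clear; lia.
Qed.
End LowDegreeMember.

(** * Suppressing a vertex of degree at most two *)

Section Suppression.
Variables (V : finType) (e : rel V).
Hypotheses (e_sym : symmetric e) (e_irr : irreflexive e).
Variables (h u w : V).
Hypotheses (hu : e h u) (hw : e h w).

(** [h] remains as an isolated vertex, so the vertex type is unchanged. Degree one is the case
    [u = w], in which no edge is added. *)
Definition suppress : rel V := fun a b =>
  [&& a != h, b != h &
      e a b || [&& u != w & (a == u) && (b == w) || (a == w) && (b == u)]].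

Lemma suppress_sym : symmetric suppress.
Proof.
move=> a b; rewrite /suppress e_sym andbCA orbC.
by rewrite [_ && (b == w) || _]orbC ![(b == _) && _]andbC orbC.
Qed.

Lemma suppress_irr : irreflexive suppress.
Proof.
move=> a; rewrite /suppress e_irr /=; apply/negP => /and3P[_ _ /andP[uw]].
by case/orP => /andP[/eqP E1 /eqP E2]; rewrite -E1 -E2 eqxx in uw.
Qed.

(** The detour through [h] is granted only to a walk whose set contains both [u] and [w]. Of two
    disjoint walks at most one qualifies, so they stay disjoint when expanded. *)
Lemma suppress_reach (S : seq V) a s : path suppress a s -> a != h ->
  {subset a :: s <= S} ->
  reach e (fun z => (z \in S) || [&& z == h, u \in S & w \in S]) a (last a s)
  /\ h \notin a :: s.
Proof.
elim: s a => [|b s IH] a /=.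
  move=> _ ah sS; split; last by rewrite inE eq_sym.
  by apply: reach_refl; rewrite sS ?mem_head.
move=> /andP[ab ps] ah sS; have bh : b != h by case/and3P: ab.
have [|R hs] := IH _ ps bh; first by move=> z zs; apply: sS; rewrite inE zs orbT.
split; last by rewrite inE negb_or eq_sym ah.
have [aS bS] : a \in S /\ b \in S by split; apply: sS; rewrite !inE eqxx ?orbT.
apply: reach_trans R; case/and3P: ab => _ _ /orP[ab|/andP[_]].
  by apply: reach_edge; rewrite // ?aS ?bS.
move=> H; have [ha hb uS wS] : [/\ e h a, e h b, u \in S & w \in S].
  by case/orP: H => /andP[/eqP E1 /eqP E2]; rewrite -E1 -E2; split; rewrite // ?E1 ?E2.
by apply: (reach2 e_sym ha hb); rewrite /= ?aS ?bS ?eqxx ?uS ?wS ?orbT.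
Qed.

(** Distinct ends exclude the constant walk at the isolated vertex [h]. *)
Lemma suppress_linked a b c d : a != b -> c != d ->
  linked suppress a b c d -> linked e a b c d.
Proof.
move=> ab cd [s [r [ps ls pr lr /hasPn dis]]].
have ne x y p : path suppress x p -> last x p = y -> x != y -> x != h.
  by case: p => [|z p] /=; [move=> _ ->; rewrite eqxx|move=> /andP[/and3P[]]].
have [Rs hs] := suppress_reach ps (ne _ _ _ ps ls ab) (fun z zs => zs).
have [Rr hr] := suppress_reach pr (ne _ _ _ pr lr cd) (fun z zr => zr).
rewrite -ls -lr; apply: linked_reach Rs Rr _ => z.
move=> /orP[zs|/and3P[/eqP -> us ws]] /orP[zr|/and3P[/eqP zh ur wr]].
- by have /= := dis _ zr; rewrite zs.
- by rewrite -zh zs in hs.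
- by rewrite zr in hr.
- by have /= := dis _ ur; rewrite us.
Qed.

(** Each pairing separates its two halves, so the three pairings together make the four vertices
    distinct. *)
Lemma suppress_crossfree : crossfree e -> crossfree suppress.
Proof.
have ne x y z v : linked suppress x y z v -> x != z /\ y != v.
  move=> [s [r [_ ls _ lr /hasPn dis]]]; split.
    apply/eqP => E; have := dis z (mem_head _ _).
    by rewrite /= -E mem_head.
  apply/eqP => E; have := dis v; rewrite -lr mem_last /= => /(_ isT).
  by rewrite lr -E -ls mem_last.
move=> H a b c d l1 l2 l3.
have [[ac bd] [ab cd]] := (ne _ _ _ _ l1, ne _ _ _ _ l2).
have [_ dc] := ne _ _ _ _ l3.
have ad : a != d.
  move: l1 => [s [r [_ _ _ lr /hasPn dis]]].
  apply: contraTneq (mem_last c r) => E; rewrite lr -E.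
  by apply/negP => /dis /=; rewrite mem_head.
have bc : b != c.
  move: l1 => [s [r [_ ls _ _ /hasPn dis]]].
  apply: contraTneq (mem_last a s) => E; rewrite ls E.
  by apply: dis; rewrite mem_head.
by apply: (H a b c d); apply: suppress_linked.
Qed.

End Suppression.

Section Bound.
Variables (V : finType) (T : finType) (t : V -> V -> T) (Q : {set V}).
Hypothesis T2 : (2 <= #|T|)%N.

Lemma crossfree_bound (e : rel V) : symmetric e -> irreflexive e -> crossfree e ->
  pairwise_joined t Q e -> (#|Q| <= 3 * #|T| + 1)%N.
Proof.
(* The induction is on the number of non-isolated vertices, because suppression isolates [h] without
   removing it. *)
pose nonisolated (e : rel V) := [set v | [exists w, e v w]].
move: {2}#|nonisolated e| (leqnn #|nonisolated e|) => n.
elim: n e => [|n IH] e le e_sym e_irr e_cross QJ.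
  have no a b : e a b = false.
    apply/negP => ab; move: le; rewrite leqn0 cards_eq0 => /eqP E.
    by have : a \in nonisolated e; [rewrite inE; apply/existsP; exists b|rewrite E inE].
  have [/eqP|/card_gt0P[v vQ]] := posnP #|Q|; first by move=> /eqP ->.
  by apply: (low_degree_bound T2 e_sym e_irr e_cross QJ vQ); rewrite eq_card0 // => z; apply: no.
have [/existsP[a /existsP[b ab]]|] := boolP [exists a, exists b, e a b]; last first.
  move=> /existsPn no; apply: (IH e) => //; rewrite (_ : nonisolated e = finset.set0) ?cards0//.
  by apply/finset.setP => z; rewrite !inE (negPf (no z)).
have [h /andP[/card_gt0P[u hu] h2]] := crossfree_low_degree e_sym e_irr e_cross ab.
have [hQ|hQ] := boolP (h \in Q); first exact: (low_degree_bound T2 e_sym e_irr e_cross QJ hQ h2).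
have [w [hw hN]] : exists w, e h w /\ forall z, e h z -> z = u \/ z = w.
  have [/existsP[w /andP[hw wu]]|/existsPn nw] := boolP [exists w, e h w && (w != u)].
    exists w; split => // z hz; have [->|zu] := eqVneq z u; first by left.
    have [->|zw] := eqVneq z w; first by right.
    move: h2; rewrite leqNgt => /negP[]; apply/card_gt2P.
    by exists u, w, z; do !split; rewrite // eq_sym.
  exists u; split => // z hz; left; apply/eqP.
  by have := nw z; rewrite hz negbK.
have QNh z : z \in Q -> z != h by apply: contraTneq => ->.
apply: (IH (suppress e h u w)).
- rewrite -ltnS; apply: leq_trans le; apply: proper_card; apply/properP; split.
    apply/fintype.subsetP => a'; rewrite !inE => /existsP[b' /and3P[_ _ /orP[a'b'|]]].
      by apply/existsP; exists b'.
    by move=> /andP[_ /orP[] /andP[/eqP -> _]]; apply/existsP; exists h; rewrite e_sym.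
  exists h; rewrite !inE; first by apply/existsP; exists u.
  by apply/existsPn => z; rewrite /suppress eqxx.
- exact: suppress_sym.
- exact: suppress_irr.
- exact: suppress_crossfree.
- move=> x y xQ yQ xy; rewrite /suppress !QNh //=.
  have [xy'|[z [zx zy tz]]] := QJ x y xQ yQ xy; first by left; rewrite xy'.
  have [E|zh] := eqVneq z h; last first.
    by right; exists z; split => //; rewrite zh ?QNh ?zx ?zy.
  (* The only vertices that [h] can tell apart are [u] and [w], which are now adjacent. *)
  rewrite E in zx zy; left; apply/orP; right; apply/andP.
  have [[Ex|Ex] [Ey|Ey]] := (hN _ zx, hN _ zy); rewrite Ex Ey in xy; rewrite Ex Ey.
  + by rewrite eqxx in xy.
  + by rewrite xy !eqxx.
  + by rewrite eq_sym xy !eqxx orbT.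
  + by rewrite eqxx in xy.
Qed.
End Bound.

(** * Coloured mixed graphs *)

Section Extrema.
Local Open Scope classical_set_scope.
Implicit Types A : set nat.

Lemma nat_max_eq A k : A k -> (forall j, A j -> (j <= k)%N) -> nat_max A = k.
Proof.
move=> Ak Ale; rewrite /nat_max; case: xgetP => [j _ [Aj jmax]|/(_ k)[]//].
by apply/eqP; rewrite eqn_leq Ale// jmax.
Qed.

Lemma nat_max_le A k : (forall j, A j -> (j <= k)%N) -> (nat_max A <= k)%N.
Proof. by move=> Ale; rewrite /nat_max; case: xgetP => [j _ [/Ale]|]. Qed.

Lemma nat_min_eq A k : A k -> (forall j, A j -> (k <= j)%N) -> nat_min A = k.
Proof.
move=> Ak Age; rewrite /nat_min; case: xgetP => [j _ [Aj jmin]|/(_ k)[]//].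
by apply/eqP; rewrite eqn_leq Age// jmin.
Qed.

Lemma nat_min_le A k : A k -> (nat_min A <= k)%N.
Proof.
move=> Ak; have exA : exists k, `[< A k >] by exists k; exact/asboolP.
case: (ex_minnP exA) => j /asboolP Aj jmin.
rewrite (nat_min_eq Aj) => [|i Ai]; last by apply: jmin; exact/asboolP.
by apply: jmin; exact/asboolP.
Qed.

End Extrema.

Section Kinds.
Variables m n : nat.

(* How a vertex sees a neighbour: through an outgoing arc, an incoming arc or
   an edge, of a given colour. *)
Definition kinds : finType := ('I_m + 'I_m + 'I_n)%type.

Definition converse (k : kinds) : kinds :=
  match k with
  | inl (inl c) => inl (inr c)
  | inl (inr c) => inl (inl c)
  | inr c => inr c
  end.

Lemma converseK : involutive converse.
Proof. by case=> [[]|]. Qed.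

Lemma converse_inj : injective converse.
Proof. by move=> k k' E; rewrite -(converseK k) E converseK. Qed.

Lemma card_kinds : #|kinds| = (2 * m + n)%N.
Proof. by rewrite !card_sum !card_ord mul2n addnn. Qed.

Definition kind (V : finType) (G : cmgraph m n V) (k : kinds) : rel V :=
  match k with
  | inl (inl c) => Defs.arc G c
  | inl (inr c) => fun u v => Defs.arc G c v u
  | inr c => edge G c
  end.

Section KindTheory.
Variables (V : finType) (G : cmgraph m n V).

Lemma kind_converse k u v : kind G (converse k) v u = kind G k u v.
Proof. by case: k => [[]|] c //=; rewrite edge_sym. Qed.

Lemma kind_uniq k k' u v : kind G k u v -> kind G k' u v -> k = k'.
Proof.
case: k k' => [[c|c]|c] [[c'|c']|c'] /= h h'.
- by rewrite (arc_color_uniq h h').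
- by rewrite (negPf (arc_asym c' h)) in h'.
- by rewrite (negPf (arc_not_edge c' h)) in h'.
- by rewrite (negPf (arc_asym c' h)) in h'.
- by rewrite (arc_color_uniq h h').
- by rewrite edge_sym (negPf (arc_not_edge c' h)) in h'.
- by rewrite (negPf (arc_not_edge c h')) in h.
- by rewrite edge_sym (negPf (arc_not_edge c h')) in h.
- by rewrite (edge_color_uniq h h').
Qed.

Lemma kind_irrefl k u : kind G k u u = false.
Proof.
case: k => [[c|c]|c] /=; last exact: edge_irrefl.
all: by apply/negP => h; move: (arc_asym c h); rewrite h.
Qed.

Lemma underlying_adjE u v : underlying_adj G u v = [exists k, kind G k u v].
Proof.
apply/orP/existsP => [[/existsP[c /orP[h|h]]|/existsP[c h]]|[[[c|c]|c] h]].
- by exists (inl (inl c)).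
- by exists (inl (inr c)).
- by exists (inr c).
- by left; apply/existsP; exists c; rewrite [X in X || _]h.
- by left; apply/existsP; exists c; rewrite [X in _ || X]h orbT.
- by right; apply/existsP; exists c.
Qed.

(** The second case is a special 2-path: identifying its ends would put two kinds on one pair. *)
Definition special (u v : V) : Prop := underlying_adj G u v \/
  exists w k k', [/\ kind G k w u, kind G k' w v & k != k'].

Lemma special_sym u v : special u v -> special v u.
Proof.
case=> [uv|[w [k [k' [wu wv kk]]]]]; last first.
  by right; exists w, k', k; rewrite eq_sym.
left; move: uv; rewrite !underlying_adjE => /existsP[k uv].
by apply/existsP; exists (converse k); rewrite kind_converse.
Qed.

End KindTheory.

Lemma is_homP (V W : finType) (G : cmgraph m n V) (H : cmgraph m n W) (f : V -> W) :
  is_hom G H f <-> forall k u v, kind G k u v -> kind H k (f u) (f v).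
Proof.
split=> [[fa fe] [[c|c]|c] u v /=|h]; [exact: fa|exact: fa|exact: fe|].
by split => c u v; [exact: (h (inl (inl c)))|exact: (h (inr c))].
Qed.

Lemma special_separated (V W : finType) (G : cmgraph m n V) (H : cmgraph m n W) f u v :
  is_hom G H f -> special G u v -> f u != f v.
Proof.
move=> /is_homP fh [|[w [k [k' [wu wv kk']]]]].
  rewrite underlying_adjE => /existsP[k /fh h].
  by apply: contraTneq h => ->; rewrite kind_irrefl.
apply: contraNneq kk' => fuv; have := fh _ _ _ wv; rewrite -fuv => h.
exact/eqP/(kind_uniq (fh _ _ _ wu) h).
Qed.

Section OfKinds.
Variables (V : finType) (K : kinds -> rel V).
Hypothesis K_converse : forall k u v, K (converse k) v u = K k u v.
Hypothesis K_irrefl : forall k u, K k u u = false.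
Hypothesis K_uniq : forall k k' u v, K k u v -> K k' u v -> k = k'.

(** Reduces the construction of a graph to three conditions, uniform in arcs and edges; it serves
    for quotients, restrictions and the fan. *)
Lemma of_kinds : {G : cmgraph m n V | forall k u v, kind G k u v = K k u v}.
Proof.
have K_ac c u v : K (inl (inr c)) v u = K (inl (inl c)) u v.
  by rewrite -(K_converse (inl (inl c))).
unshelve eexists.
  apply: (@CMGraph m n V (fun c => K (inl (inl c))) (fun c => K (inr c))).
  - by move=> c u v; rewrite -(K_converse (inr c)).
  - by move=> c u; rewrite K_irrefl.
  - by move=> c c' u v h; apply/negP; rewrite -K_ac => /(K_uniq h).
  - by move=> c c' u v h /(K_uniq h)[].
  - by move=> c c' u v h /(K_uniq h)[].
  - by move=> c c' u v h; apply/negP => /(K_uniq h).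
by move=> [[c|c]|c] u v //=; rewrite K_ac.
Qed.

End OfKinds.

(** If [u] and [v] are not special they can be identified: being non-adjacent they create no loop,
    and their common neighbours see both alike, so no pair receives two kinds. *)
Lemma relative_clique_special (V : finType) (G : cmgraph m n V) (S : {set V}) :
  is_relative_clique G S -> {in S &, forall u v, u != v -> special G u v}.
Proof.
move=> cS u v uS vS uv; apply: contrapT => nsp.
have nadj k : ~~ kind G k u v /\ ~~ kind G k v u.
  split; apply/negP => h; apply: nsp; left; rewrite underlying_adjE; apply/existsP.
    by exists k.
  by exists (converse k); rewrite kind_converse.
have same w k k' : kind G k w u -> kind G k' w v -> k = k'.
  by move=> wu wv; apply/eqP; apply: contrapT => /negP kk; apply: nsp; right; exists w, k, k'.
pose f z := if z == v then u else z.
have fE x x' : f x = f x' -> [\/ x = x', x = u /\ x' = v | x = v /\ x' = u].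
  rewrite /f; case: (eqVneq x v) => [->|xv]; case: (eqVneq x' v) => [->|x'v] E.
  - by constructor.
  - by constructor 3.
  - by constructor 2.
  - by constructor.
(* The quotient is placed on [V] itself, where [v] becomes isolated. *)
pose K k a b := [exists x, exists y, [&& f x == a, f y == b & kind G k x y]].
have KI k a b : K k a b -> exists x y, [/\ f x = a, f y = b & kind G k x y].
  by move=> /existsP[x /existsP[y /and3P[/eqP ? /eqP ? ?]]]; exists x, y.
have Kf k x y : kind G k x y -> K k (f x) (f y).
  by move=> h; apply/existsP; exists x; apply/existsP; exists y; rewrite !eqxx.
have [||| H HK] := of_kinds (K := K).
- have conv k a b : K k a b -> K (converse k) b a.
    by move=> /KI[x [y [<- <- h]]]; apply: Kf; rewrite kind_converse.
  by move=> k a b; apply/idP/idP => /conv //; rewrite converseK.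
- move=> k a; case Kaa: (K k a a) => //; have [x [y [fx fy h]]] := KI _ _ _ Kaa.
  have [E|[E E']|[E E']] := fE x y (etrans fx (esym fy)); move: h; rewrite E ?E'.
  + by rewrite kind_irrefl.
  + by rewrite (negPf (nadj k).1).
  + by rewrite (negPf (nadj k).2).
- move=> k k' a b Kab K'ab; have [x [y [fx fy h]]] := KI _ _ _ Kab.
  have [x' [y' [fx' fy' h']]] := KI _ _ _ K'ab.
  have := fE x x' (etrans fx (esym fx')); have := fE y y' (etrans fy (esym fy')).
  have bad p q i : [\/ p = u | p = v] -> [\/ q = u | q = v] -> ~~ kind G i p q.
    by move=> [] -> [] ->; rewrite ?kind_irrefl ?(nadj i).1 ?(nadj i).2.
  case=> [Ey|[Ey Ey']|[Ey Ey']] [Ex|[Ex Ex']|[Ex Ex']].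
  + by rewrite Ex Ey in h; exact: kind_uniq h h'.
  + rewrite Ex Ey in h; rewrite Ex' in h'.
    by apply: converse_inj; apply: (same y'); rewrite kind_converse.
  + rewrite Ex Ey in h; rewrite Ex' in h'.
    by apply/esym/converse_inj; apply: (same y'); rewrite kind_converse.
  + by rewrite Ex Ey in h; rewrite Ey' in h'; exact: same h h'.
  + by rewrite (negPf (bad x y k _ _)) in h; auto.
  + by rewrite (negPf (bad x y k _ _)) in h; auto.
  + by rewrite Ex Ey in h; rewrite Ey' in h'; apply/esym/(same x').
  + by rewrite (negPf (bad x y k _ _)) in h; auto.
  + by rewrite (negPf (bad x y k _ _)) in h; auto.
have fh : is_hom G H f by apply/is_homP => k x y /Kf; rewrite HK.
have fuv : f u = f v by rewrite /f eqxx (negPf uv).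
by move/eqP: uv; apply; exact: (cS _ _ _ fh).
Qed.

Lemma separated_card (V W : finType) (G : cmgraph m n V) (H : cmgraph m n W) f :
  (forall u v, u != v -> special G u v) -> is_hom G H f -> (#|V| <= #|W|)%N.
Proof.
move=> sp fh; apply: (@leq_card _ _ f) => u v fuv.
by apply/eqP; apply: contrapT => /negP /sp /(special_separated fh); rewrite fuv eqxx.
Qed.

Lemma special_clique (V : finType) (G : cmgraph m n V) :
  (forall u v, u != v -> special G u v) -> is_clique G.
Proof.
move=> sp; apply: nat_min_eq.
  by exists V, G, id; split => //; split.
by move=> _ [W [H [f [fh <-]]]]; exact: separated_card fh.
Qed.

Lemma restrict (V : finType) (P : pred V) (G : cmgraph m n V) :
  {H : cmgraph m n {x | P x} | forall k u v, kind H k u v = kind G k (val u) (val v)}.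
Proof.
apply: of_kinds => [k u v|k u|k k' u v].
- exact: kind_converse.
- exact: kind_irrefl.
- exact: kind_uniq.
Qed.

(** The image of [S] under [f] carries a target for [H], so it has at least [chi H = #|S|] vertices
    and [f] is injective on [S]. One upper bound thus serves both parameters. *)
Lemma clique_relative (V : finType) (G : cmgraph m n V) (S : {set V})
  (H : cmgraph m n {x | x \in S}) : is_subgraph G H -> is_clique H -> is_relative_clique G S.
Proof.
move=> /is_homP sub cl W G' f /is_homP fh u v uS vS fuv.
pose g (z : {x | x \in S}) := f (val z).
have [G'' G''E] := restrict [in codom g] G'.
pose g' z : {x | x \in codom g} := exist _ (g z) (codom_f g z).
have : (#|{: {x | x \in S}}| <= #|codom g|)%N.
  rewrite -{1}cl -card_sig; apply: nat_min_le; exists _, G'', g'; split => //.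
  by apply/is_homP => k z w /sub /fh h; rewrite G''E.
rewrite leqNgt => /negP le; apply/eqP; apply: contrapT => uv; apply: le.
rewrite ltn_neqAle leq_image_card andbT; apply/negP => /image_injP inj.
apply: uv; apply/eqP.
by have [] : exist (fun x => x \in S) u uS = exist (fun x => x \in S) v vS by exact: inj.
Qed.
End Kinds.

(** * The upper bound for coloured graphs *)

Section UpperBound.
Variables m n : nat.
Hypothesis mn01 : (m, n) <> (0, 1)%N.

Lemma kinds_card_neq1 : #|kinds m n| != 1%N.
Proof.
apply/eqP; rewrite card_kinds; case: m n mn01 => [|m'] [|[|n']] //=; lia.
Qed.

Lemma relative_clique_bound (G : sgraph) (H : cmgraph m n G) (S : {set G}) :
  underlying_adj H =2 @adj G -> crossfree (@adj G) ->
  is_relative_clique H S -> (#|S| <= 3 * (2 * m + n) + 1)%N.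
Proof.
move=> HG cross /relative_clique_special sp; rewrite -card_kinds.
have [T0|Tpos] := posnP #|kinds m n|.
  rewrite T0 muln0 leqNgt; apply/negP => /card_gt1P[u [v [uS vS uv]]].
  suff [k] : exists k : kinds m n, true by have := card0_eq T0 k.
  have [|[w [k _]]] := sp u v uS vS uv; last by exists k.
  by rewrite underlying_adjE => /existsP[k]; exists k.
have T2 : (2 <= #|kinds m n|)%N by rewrite ltn_neqAle eq_sym kinds_card_neq1.
have [k0 _] := card_gt0P Tpos.
(* Only the values on adjacent pairs are prescribed; [k0] fills in the others. *)
pose t (w u : G) := if [pick k | kind H k w u] is Some k then k else k0.
have tE k w u : kind H k w u -> t w u = k.
  move=> wu; rewrite /t; case: pickP => [k' /kind_uniq|/(_ k)]; last by rewrite wu.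
  exact.
have kadj k w u : kind H k w u -> adj w u.
  by move=> wu; rewrite -HG underlying_adjE; apply/existsP; exists k.
apply: (crossfree_bound (t := t) T2 (@adj_sym G) (@adj_irrefl G) cross) => u v uS vS uv.
have [|[w [k [k' [wu wv kk]]]]] := sp u v uS vS uv; first by rewrite HG; left.
by right; exists w; rewrite (tE _ _ _ wu) (tE _ _ _ wv) (kadj _ _ _ wu) (kadj _ _ _ wv).
Qed.

End UpperBound.

(** * The extremal fan *)

Section Fan.
Variables m n : nat.
Hypothesis mn01 : (m, n) <> (0, 1)%N.
Let N := (3 * #|kinds m n|)%N.

Definition fan_adj (u v : option 'I_N) : bool :=
  match u, v with
  | None, None => false
  | Some k, Some l => (k.+1 == l) || (l.+1 == k)
  | _, _ => true
  end.

Lemma fan_adj_sym : symmetric fan_adj.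
Proof. by case=> [k|] [l|] //=; rewrite orbC. Qed.

Lemma fan_adj_irrefl : irreflexive fan_adj.
Proof. by case=> [k|] //=; apply/negbTE; rewrite orbb neq_ltn ltnSn orbT. Qed.

Definition fan : sgraph := SGraph fan_adj_sym fan_adj_irrefl.

Lemma spoke_subproof (k : 'I_N) : (k %/ 3 < #|kinds m n|)%N.
Proof. by rewrite ltn_divLR // mulnC. Qed.

Definition spoke_kind (k : 'I_N) : kinds m n := enum_val (Ordinal (spoke_subproof k)).

(** [r i] is the kind from rim vertex [i] to [i + 1]. Vertex [i + 1] sees its predecessor by
    [converse (r i)] and its successor by [r i.+1], and these have to differ: a directed path does
    it if there is an arc colour, two alternating edge colours otherwise. [None] is for the case
    without kinds, where the rim is empty. *)
Lemma rim_kinds : exists r : nat -> option (kinds m n),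
  ((0 < N)%N -> forall i, exists k, r i = Some k) /\
  forall i k k', r i = Some k -> r i.+1 = Some k' -> converse k != k'.
Proof.
case: (posnP m) => [m0|mpos]; last first.
  exists (fun=> Some (inl (inl (Ordinal mpos)))); split; first by move=> _ i; eexists.
  by move=> i k k' [<-] [<-].
case: (ltnP 1 n) => [n2|n1].
  exists (fun i => Some (inr (Ordinal (leq_ltn_trans (leq_b1 (odd i)) n2)))).
  split; first by move=> _ i; eexists.
  move=> i k k' [<-] [<-] /=; apply/eqP => -[] /=.
  by case: (odd i).
exists (fun=> None); split => //.
rewrite /N card_kinds m0; case: (n) n1 mn01 => [|[|]] //; by rewrite m0.
Qed.

Lemma fan_coloring : exists H : cmgraph m n fan, underlying_adj H =2 @adj fan /\
  forall u v, u != v -> special H u v.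
Proof.
have [r [rsome rconv]] := rim_kinds.
pose K (k : kinds m n) (u v : fan) := match u, v with
  | None, None => false
  | None, Some j => k == spoke_kind j
  | Some i, None => converse k == spoke_kind i
  | Some i, Some j => (i.+1 == j) && (Some k == r i) ||
                      (j.+1 == i) && (Some (converse k) == r j)
  end.
have [||| H HK] := @of_kinds m n fan K.
- by move=> k [i|] [j|] //=; rewrite converseK // orbC.
- by move=> k [i|] //=; rewrite -[_.+1 == _ :> nat]/(i.+1 == i) eqn_leq ltnn.
- move=> k k' [i|] [j|] //=.
  + move=> /orP[] /andP[/eqP ij /eqP E] /orP[] /andP[/eqP ij' /eqP E'].
    * by move: E'; rewrite -E => -[].
    * by move: ij ij'; clear; lia.
    * by move: ij ij'; clear; lia.
    * by move: E'; rewrite -E => -[/converse_inj].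
  + by move=> /eqP <- /eqP /converse_inj.
  + by move=> /eqP -> /eqP.
have Npos (i : 'I_N) : (0 < N)%N by apply: leq_ltn_trans (ltn_ord i).
have adjE : underlying_adj H =2 @adj fan.
  move=> u v; rewrite underlying_adjE; apply/existsP/idP => [[k]|].
    rewrite HK; case: u v => [i|] [j|] //=.
    by move=> /orP[] /andP[-> _]; rewrite ?orbT.
  have ex i : (0 < N)%N -> exists k, r i = Some k by move=> /rsome.
  case: u v => [i|] [j|] //=.
  - move=> /orP[] ij.
      by have [k rk] := ex i (Npos i); exists k; rewrite HK /= ij rk eqxx.
    have [k rk] := ex j (Npos i); exists (converse k).
    by rewrite HK /= ij converseK rk eqxx orbT.
  - by exists (converse (spoke_kind i)); rewrite HK /= converseK.
  - by exists (spoke_kind j); rewrite HK /=.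
exists H; split => // u v uv.
have far (i j : 'I_N) : (i < j)%N -> special H (Some i) (Some j).
  move=> ij.
  have [E|ne] := eqVneq (spoke_kind i) (spoke_kind j); last first.
    by right; exists None, (spoke_kind i), (spoke_kind j); rewrite !HK /=.
  have dij : (i %/ 3 = j %/ 3)%N by have /(congr1 val) := enum_val_inj E.
  have [E1|i1] := eqVneq i.+1 (j : nat); first by left; rewrite adjE /= E1 eqxx.
  (* Two non-consecutive vertices in one block of three are at distance two, and the rim vertex
     between them separates them. *)
  have E2 : i.+2 = j.
    have := divn_eq i 3; have := divn_eq j 3; rewrite dij.
    have := ltn_pmod i (isT : 0 < 3)%N; have := ltn_pmod j (isT : 0 < 3)%N.
    by move/eqP: i1; move: ij; clear; lia.
  have wN : (i.+1 < N)%N by apply: leq_ltn_trans (ltn_ord j); rewrite -E2.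
  have [k rk] := rsome (Npos i) i; have [k' rk'] := rsome (Npos i) i.+1.
  right; exists (Some (Ordinal wN)), (converse k), k'; rewrite !HK /= converseK rk rk' E2 !eqxx orbT.
  by split => //; apply: rconv rk rk'.
case: u v uv => [i|] [j|] //= uv; [|by left; rewrite adjE|by left; rewrite adjE].
have [ij|ji] := ltnP i j; first exact: far.
apply/special_sym/far; rewrite ltn_neqAle ji andbT.
by apply: contraNneq uv => E; apply/eqP; congr Some; apply: val_inj.
Qed.

Lemma card_fan : #|fan| = (3 * (2 * m + n) + 1)%N.
Proof. by rewrite card_option card_ord /N card_kinds addn1. Qed.

End Fan.

(** * Nonplanarity of K_5 *)

Section Winding.
Variable R : realType.
Local Notation plane := (R * R)%type.
Implicit Types (z w : plane) (d : R).

(** Counting the positive half of the axis as upper makes exactly one of [z] and [- z] upper when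
    [z] is nonzero. *)
Definition upper z : bool := (0 < z.2) || (z.2 == 0) && (0 < z.1).

(* The step from [z] to [w] passes through the positive horizontal axis. *)
Definition crosses z w : bool := (upper z (+) upper w) && (0 < z.1).

Lemma norm_pair_lt z d : (`|z| < d) = (`|z.1| < d) && (`|z.2| < d).
Proof. by rewrite /Num.norm/= gt_max. Qed.

Lemma norm_pair_ge z d : (d <= `|z|) = (d <= `|z.1|) || (d <= `|z.2|).
Proof. by rewrite /Num.norm/= le_max. Qed.

Lemma upperN z : z != 0 -> upper (- z) = ~~ upper z.
Proof.
rewrite /upper /=; case: z => x y /=; rewrite -pair_eqE /pair_eq /= => nz.
rewrite oppr_gt0 oppr_eq0 oppr_gt0.
by case: (ltgtP y 0) nz => //= _; case: (ltgtP x 0).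
Qed.

(** The norm is the maximum norm. Points closer than [d] to each other that meet both halves have
    ordinates below [d], hence abscissae at least [d] in absolute value and of one sign. *)
Lemma same_side d z z' w : d <= `|z| -> d <= `|w| ->
  `|z - z'| < d -> `|z - w| < d -> `|z' - w| < d ->
  upper z != upper z' -> (0 < w.1) = (0 < z.1).
Proof.
rewrite !norm_pair_lt !norm_pair_ge /upper.
case: z z' w => [x y] [x' y'] [u v] /= zd wd.
rewrite !ltr_norml => /andP[/andP[a1 a2] /andP[a3 a4]].
move=> /andP[/andP[b1 b2] /andP[b3 b4]] /andP[/andP[c1 c2] /andP[c3 c4]] neq.
have [yd vd] : `|y| < d /\ `|v| < d.
  rewrite !ltr_norml.
  by case: (ltgtP y 0) neq; case: (ltgtP y' 0) => //= ? ? _; split; lra.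
move: zd wd; rewrite (leNgt d `|y|) yd (leNgt d `|v|) vd !orbF.
rewrite !ler_normr => /orP[] ? /orP[] ?;
  by case: (ltP 0 x) => ?; case: (ltP 0 u) => ? //; lra.
Qed.

(** Within one half nothing is crossed; otherwise [same_side] gives all four abscissae one sign, and
    both sums depend only on [z1] and [z3]. *)
Lemma crosses_square d z1 z2 z3 z4 :
  (forall i j, i \in [:: z1; z2; z3; z4] -> j \in [:: z1; z2; z3; z4] ->
     d <= `|i| /\ `|i - j| < d) ->
  crosses z1 z2 (+) crosses z2 z3 = crosses z1 z4 (+) crosses z4 z3.
Proof.
move=> H.
have S i j w : i \in [:: z1; z2; z3; z4] -> j \in [:: z1; z2; z3; z4] ->
    w \in [:: z1; z2; z3; z4] -> upper i != upper j -> (0 < w.1) = (0 < i.1).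
  move=> iz jz wz; have [di dij] := H _ _ iz jz.
  by apply: (@same_side d); [|case: (H _ _ wz wz)| |case: (H _ _ iz wz)|case: (H _ _ jz wz)].
rewrite /crosses.
have [m1 m2 m3 m4] : [/\ z1 \in [:: z1; z2; z3; z4], z2 \in [:: z1; z2; z3; z4],
   z3 \in [:: z1; z2; z3; z4] & z4 \in [:: z1; z2; z3; z4]].
  by split; rewrite !inE eqxx ?orbT.
have [e12|e12] := eqVneq (upper z1) (upper z2); last first.
  rewrite (S _ _ _ m1 m2 m2 e12) (S _ _ _ m1 m2 m4 e12).
  by case: (upper z1) (upper z2) (upper z3) (upper z4) (0 < z1.1) => [] [] [] [] [].
have [e13|e13] := eqVneq (upper z1) (upper z3); last first.
  rewrite (S _ _ _ m1 m3 m2 e13) (S _ _ _ m1 m3 m4 e13).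
  by case: (upper z1) (upper z2) (upper z3) (upper z4) (0 < z1.1) => [] [] [] [] [].
have [e14|e14] := eqVneq (upper z1) (upper z4); last first.
  rewrite (S _ _ _ m1 m4 m2 e14) (S _ _ _ m1 m4 m4 e14).
  by case: (upper z1) (upper z2) (upper z3) (upper z4) (0 < z1.1) => [] [] [] [] [].
by rewrite -e12 -e13 -e14; case: (upper z1).
Qed.

(** A step that changes halves crosses either the positive or the negative axis, and negation
    exchanges the two. *)
Lemma crossesN d z w : d <= `|z| -> d <= `|w| -> `|z - w| < d -> 0 < d ->
  crosses (- z) (- w) = crosses z w (+) (upper z (+) upper w).
Proof.
move=> dz dw zw d0.
have z0 : z != 0 by rewrite -normr_gt0 (lt_le_trans d0).
have w0 : w != 0 by rewrite -normr_gt0 (lt_le_trans d0).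
rewrite /crosses !upperN //.
have [e|ne] := eqVneq (upper z) (upper w); first by rewrite e !addbb.
have -> : ~~ upper z (+) ~~ upper w = true by move: ne; case: (upper z); case: (upper w).
have -> : upper z (+) upper w = true by move: ne; case: (upper z); case: (upper w).
rewrite /= oppr_gt0; suff : z.1 != 0 by case: (ltgtP z.1 0).
move: ne dz zw; rewrite /upper norm_pair_lt norm_pair_ge.
case: z w {dw z0 w0} => [x y] [u v] /=; rewrite !ltr_norml !ler_normr.
move=> ne dz /andP[_ /andP[? ?]]; apply/eqP => x0.
rewrite x0 oppr0 ltxx andbF orbF in ne dz.
by move: ne; case: (ltgtP 0 y); case: (ltgtP v 0) => //=;
  move: dz => /orP[/orP[] ?|/orP[] ?] *; lra.
Qed.

(** Parity of crossings with a ray from [w]: to the right for [f v = v - w], to the left for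
    [f v = w - v]. *)
Fixpoint winding (f : plane -> plane) z (s : seq plane) : bool :=
  if s is z' :: s' then crosses (f z) (f z') (+) winding f z' s' else false.

Definition chain d : plane -> seq plane -> bool :=
  path (fun z w => `|z - w| < d).

(** The factor 2: a difference [z - w] moves by less than [2 * d] when both points make one step. *)
Definition apart d (s t : seq plane) :=
  forall z w, z \in s -> w \in t -> 2 * d <= `|z - w|.

Lemma winding_strip d z s w w' : 0 < d -> chain d z s -> `|w - w'| < d ->
  apart d (z :: s) [:: w; w'] ->
  winding (fun v => v - w) z s (+) winding (fun v => v - w') z s =
  crosses (z - w) (z - w') (+) crosses (last z s - w) (last z s - w').
Proof.
move=> d0 + ww'; elim: s z => [|z' s IH] z /=; first by rewrite addbb.
move=> /andP[zz' cs] sep.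
have /IH : chain d z' s by [].
move=> /(_ _)/wrap[]; first by move=> a b az bw; apply: sep => //; rewrite inE az orbT.
move=> E; rewrite addbACA E.
have : crosses (z - w) (z' - w) (+) crosses (z' - w) (z' - w') =
  crosses (z - w) (z - w') (+) crosses (z - w') (z' - w').
  apply: (@crosses_square (2 * d)) => i j iz jz.
  have [a [c [ai ci ->]]] : exists a c, [/\ a \in [:: z; z'], c \in [:: w; w'] & i = a - c].
    by move: iz; rewrite !inE => /or4P[] /eqP ->;
      do 2!eexists; (split; last reflexivity); rewrite !inE eqxx ?orbT.
  have [b [e [bj ej ->]]] : exists a c, [/\ a \in [:: z; z'], c \in [:: w; w'] & j = a - c].
    by move: jz; rewrite !inE => /or4P[] /eqP ->;
      do 2!eexists; (split; last reflexivity); rewrite !inE eqxx ?orbT.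
  split.
    by apply: sep => //; move: ai; rewrite !inE => /orP[] ->; rewrite ?orbT.
  have -> : a - c - (b - e) = (a - b) - (c - e) by rewrite !opprB addrACA [RHS]addrC addrAC !addrA; ring.
  apply: (le_lt_trans (ler_normB _ _)).
  have -> : 2 * d = d + d by ring.
  apply: ltrD.
    move: ai bj; rewrite !inE => /orP[] /eqP -> /orP[] /eqP -> //;
    by rewrite ?subrr ?normr0 // distrC.
  move: ci ej; rewrite !inE => /orP[] /eqP -> /orP[] /eqP -> //;
  by rewrite ?subrr ?normr0 // distrC.
by do 6!case: (crosses _ _).
Qed.

Lemma winding_opp d w z s : 0 < d -> chain d z s -> apart d [:: w] (z :: s) ->
  winding (fun v => w - v) z s =
  winding (fun v => v - w) z s (+) (upper (w - z) (+) upper (w - last z s)).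
Proof.
move=> d0; elim: s z => [|z' s IH] z /=; first by rewrite addbb.
move=> /andP[zz' cs] sep.
rewrite IH //; last by move=> a b aw bz; apply: sep => //; rewrite inE bz orbT.
have -> : crosses (z - w) (z' - w) =
    crosses (w - z) (w - z') (+) (upper (w - z) (+) upper (w - z')).
  rewrite -(opprB w z) -(opprB w z').
  apply: (@crossesN (2 * d)).
  - by apply: sep; rewrite !inE eqxx.
  - by apply: sep; rewrite !inE eqxx ?orbT.
  - have -> : w - z - (w - z') = z' - z by rewrite opprB addrC addrA subrK.
    by rewrite distrC; apply: (lt_trans zz'); lra.
  - lra.
by do 2!case: (upper _); case: (crosses _ _); case: (winding _ _ _); case: (upper _).
Qed.

(** The differences of points of the two chains form a grid of small squares away from the origin.
    Each square contributes nothing, so the four sides of the grid cancel; [winding_strip] is one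
    row. *)
Lemma winding_grid d z s w t : 0 < d -> chain d z s -> chain d w t ->
  apart d (z :: s) (w :: t) ->
  winding (fun v => v - w) z s (+) winding (fun v => v - last w t) z s =
  winding (fun v => z - v) w t (+) winding (fun v => last z s - v) w t.
Proof.
move=> d0 cs; elim: t w => [|w' t IH] w /=; first by rewrite !addbb.
move=> /andP[ww' ct] sep.
have /(_ ct) IHw : chain d w' t -> _ := fun c => IH w' c (fun a b az bw =>
  sep a b az (mem_behead (s := w :: w' :: t) bw)).
have strip : winding (fun v => v - w) z s (+) winding (fun v => v - w') z s =
    crosses (z - w) (z - w') (+) crosses (last z s - w) (last z s - w').
  apply: (@winding_strip d) => // a b az bw; apply: sep => //.
  by move: bw; rewrite !inE => /orP[] ->; rewrite ?orbT.
rewrite addbACA -IHw -strip.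
by do 3!case: (winding _ _ _).
Qed.

(** [winding_grid] with all rays turned to the right, at the cost of the [upper] terms. Each chain
    now enters only through its windings about the ends of the other, so that terms from different
    pairs can cancel. *)
Lemma winding_pair d z s w t z' w' : 0 < d -> chain d z s -> chain d w t ->
  apart d (z :: s) (w :: t) -> last z s = z' -> last w t = w' ->
  winding (fun v => v - w) z s (+) winding (fun v => v - w') z s
  (+) (winding (fun v => v - z) w t (+) winding (fun v => v - z') w t)
  (+) (upper (w - z) (+) upper (w' - z) (+) (upper (w - z') (+) upper (w' - z')))
  = false.
Proof.
move=> d0 cs ct sep <- <-; rewrite (winding_grid d0 cs ct sep).
have zs : last z s \in z :: s by exact: mem_last.
have sepv v : v \in z :: s -> apart d [:: v] (w :: t).
  by move=> vz a b; rewrite inE => /eqP ->; apply: sep.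
have sepv' := sepv _ (mem_head _ _).
rewrite (winding_opp d0 ct (sepv _ (mem_head _ _))) (winding_opp d0 ct (sepv _ zs)).
have N v a : v \in z :: s -> a \in w :: t -> upper (v - a) = ~~ upper (a - v).
  move=> vz aw; rewrite -(opprB a v) upperN // -normr_gt0 distrC.
  by apply: lt_le_trans (sep _ _ vz aw); lra.
rewrite !(N z) ?(N (last z s)) ?mem_head ?mem_last//.
by do 4!case: (upper _); do 2!case: (winding _ _ _).
Qed.

End Winding.

Local Open Scope classical_set_scope.

(** The class of [x] is open and closed in [A]. *)
Lemma connected_locally (T : topologicalType) (A : set T) (E : T -> T -> Prop) :
  connected A -> (forall x, A x -> E x x) -> (forall x y, E x y -> E y x) ->
  (forall x y z, E x y -> E y z -> E x z) ->
  (forall x, A x -> exists U, [/\ open U, U x & forall y, A y -> U y -> E x y]) ->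
  forall x y, A x -> A y -> E x y.
Proof.
move=> cA refl sym trans loc x y Ax Ay.
have {}loc z : exists U, A z -> [/\ open U, U z & forall y, A y -> U y -> E z y].
  have [/loc[U ?]|Az] := pselect (A z); first by exists U.
  by exists set0 => /Az.
have [U HU] := choice loc.
suff B : [set z | A z /\ E x z] = A by move: Ay; rewrite -B => -[].
apply: cA.
- by exists x; split => //; exact: refl.
- exists (\bigcup_(z in [set z | A z /\ E x z]) U z).
    by apply: bigcup_open => z [/HU[]].
  apply/seteqP; split => z /=.
    by move=> [Az xz]; split => //; exists z => //; case: (HU _ Az).
  move=> [Az [w [Aw xw] Uwz]]; split => //; apply: trans xw _.
  by have [_ _] := HU _ Aw; apply.
- exists (~` \bigcup_(z in [set z | A z /\ ~ E x z]) U z).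
    by apply: open_closedC; apply: bigcup_open => z [/HU[]].
  apply/seteqP; split => z /=.
    move=> [Az xz]; split => // -[w [Aw xw] Uwz]; apply: xw.
    by apply: (trans _ z) => //; apply: sym; have [_ _] := HU _ Aw; apply.
  move=> [Az nz]; split => //; apply: contrapT => nxz; apply: nz.
  by exists z => //; have [] := HU _ Az.
Qed.

Section PlanarK5.
Variable R : realType.
Local Notation plane := (R * R)%type.
Implicit Types (z w : plane) (d : R) (s t : seq plane).

Lemma connected_chain (K : set plane) d z w : 0 < d -> connected K -> K z -> K w ->
  exists s, [/\ chain d z s, last z s = w & {in z :: s, forall v, K v}].
Proof.
move=> d0 cK Kz Kw.
pose E z w := exists s, [/\ chain d z s, last z s = w & {in z :: s, forall v, K v}].
apply: (connected_locally (E := E) cK) Kz Kw.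
- by move=> x Kx; exists [::]; split => // v; rewrite inE => /eqP ->.
- move=> x y [s [cs <- sK]]; exists (rev (belast x s)); split.
  + by rewrite /chain rev_path; apply: sub_path cs => a b; rewrite distrC.
  + by case: (s) => //= a s'; rewrite rev_cons last_rcons.
  + by move=> v; rewrite -rev_rcons -lastI mem_rev; exact: sK.
- move=> x y v [s [cs <- sK]] [t [ct <- tK]]; exists (s ++ t); split.
  + by rewrite /chain cat_path; apply/andP.
  + by rewrite last_cat.
  + move=> a; rewrite -cat_cons mem_cat => /orP[/sK//|ta].
    by apply: tK; rewrite inE ta orbT.
- move=> x Kx; exists (ball x d); split; first exact: ball_open.
    exact: ballxx.
  move=> y Ky; rewrite -ball_normE /= => xy; exists [:: y]; split => //=.
    by rewrite /chain /= xy.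
  by move=> v; rewrite !inE => /orP[] /eqP ->.
Qed.

Lemma disjoint_compact_dist (A B : set plane) : compact A -> compact B ->
  (forall z, A z -> B z -> False) ->
  exists2 d, 0 < d & forall z w, A z -> B w -> d <= `|z - w|.
Proof.
move=> cA cB AB.
pose D := (fun x : plane * plane => x.1 - x.2) @` (A `*` B).
have cD : compact D.
  apply: continuous_compact; last exact: compact_setX.
  apply: continuous_subspaceT => x.
  by apply: cvgB; [exact: cvg_fst|exact: cvg_snd].
have : nbhs (0 : plane) (~` D).
  apply: open_nbhs_nbhs; split.
    by apply: closed_openC; apply: compact_closed => //; exact: norm_hausdorff.
  by move=> [[z w] [/= Az Bw]] /subr0_eq zw; apply: (AB z) => //; rewrite zw.
move=> /nbhs_normP[d /= d0 dD]; exists d => // z w Az Bw.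
rewrite leNgt; apply/negP => lt; apply: (dD (z - w)).
  by rewrite /= sub0r normrN.
by exists (z, w).
Qed.

(* Sum the relation over the 15 pairs of independent edges: each [th k i j]
   occurs twice and each [u i j] six times, with one negation for each of the
   five crossings of a convex pentagon. *)
Lemma K5_parity (th : nat -> nat -> nat -> bool) (u : nat -> nat -> bool) :
  (forall i j, (i < j < 5)%N -> u j i = ~~ u i j) ->
  (forall i j k l, (i < j < 5)%N -> (k < l < 5)%N -> uniq [:: i; j; k; l] ->
     th k i j (+) th l i j (+) (th i k l (+) th j k l)
     (+) (u i k (+) u i l (+) (u j k (+) u j l)) = false) ->
  False.
Proof.
move=> uN H.
have addbE a b : a (+) b = xorb a b by case: a; case: b.
have E1 := (H 0 1 2 3 isT isT isT)%N; have E2 := (H 0 1 2 4 isT isT isT)%N.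
have E3 := (H 0 1 3 4 isT isT isT)%N; have E4 := (H 0 2 1 3 isT isT isT)%N.
have E5 := (H 0 2 1 4 isT isT isT)%N; have E6 := (H 0 2 3 4 isT isT isT)%N.
have E7 := (H 0 3 1 2 isT isT isT)%N; have E8 := (H 0 3 1 4 isT isT isT)%N.
have E9 := (H 0 3 2 4 isT isT isT)%N; have E10 := (H 0 4 1 2 isT isT isT)%N.
have E11 := (H 0 4 1 3 isT isT isT)%N; have E12 := (H 0 4 2 3 isT isT isT)%N.
have E13 := (H 1 2 3 4 isT isT isT)%N; have E14 := (H 1 3 2 4 isT isT isT)%N.
have E15 := (H 1 4 2 3 isT isT isT)%N.
have uE := (uN 0 1 isT, uN 0 2 isT, uN 0 3 isT, uN 0 4 isT, uN 1 2 isT, uN 1 3 isT,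
  uN 1 4 isT, uN 2 3 isT, uN 2 4 isT, uN 3 4 isT)%N.
have := congr2 addb (congr2 addb (congr2 addb (congr2 addb E1 E2) (congr2 addb E3 E4))
    (congr2 addb (congr2 addb E5 E6) (congr2 addb E7 E8)))
  (congr2 addb (congr2 addb (congr2 addb E9 E10) (congr2 addb E11 E12))
    (congr2 addb (congr2 addb E13 E14) E15)).
rewrite !uE /= !addbE.
set lhs := (X in X = _); suff -> : lhs = true by [].
by rewrite /lhs; btauto.
Qed.

Lemma K5_not_planar (P : nat -> plane) (K : nat -> nat -> set plane) :
  (forall i j, (i < j < 5)%N ->
     [/\ compact (K i j), connected (K i j), K i j (P i) & K i j (P j)]) ->
  (forall i j k l, (i < j < 5)%N -> (k < l < 5)%N -> uniq [:: i; j; k; l] ->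
     forall z, K i j z -> K k l z -> False) ->
  False.
Proof.
move=> HK HD.
(* One step size for all edges: the minimum over the finitely many independent pairs. *)
have [d d0 dK] : exists2 d, 0 < d & forall i j k l, (i < j < 5)%N -> (k < l < 5)%N ->
    uniq [:: i; j; k; l] -> forall z w, K i j z -> K k l w -> 2 * d <= `|z - w|.
  have /choice[f Hf] : forall q : 'I_5 * 'I_5 * ('I_5 * 'I_5), exists d, 0 < d /\
     ((q.1.1 < q.1.2)%N -> (q.2.1 < q.2.2)%N ->
       uniq [:: val q.1.1; val q.1.2; val q.2.1; val q.2.2] ->
     forall z w, K q.1.1 q.1.2 z -> K q.2.1 q.2.2 w -> 2 * d <= `|z - w|).
    move=> [[i j] [k l]] /=.
    have [/and3P[ij kl ijkl]|] :=
      boolP [&& (i < j)%N, (k < l)%N & uniq [:: val i; val j; val k; val l]]; last first.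
      by move=> /negP H; exists 1; split => // ij kl ijkl; case: H; apply/and3P.
    have ij5 : (i < j < 5)%N by rewrite ij ltn_ord.
    have kl5 : (k < l < 5)%N by rewrite kl ltn_ord.
    have [cij _ _ _] := HK _ _ ij5; have [ckl _ _ _] := HK _ _ kl5.
    have [d d0 dK] := disjoint_compact_dist cij ckl (HD _ _ _ _ ij5 kl5 ijkl).
    exists (d / 2); split; first by rewrite divr_gt0.
    by move=> _ _ _ z w Kz Kw; rewrite mulrC divfK ?pnatr_eq0//; exact: dK.
  exists (\big[Num.min/1]_q f q).
    by elim/big_ind: _ => // [x y x0 y0|q _]; [rewrite lt_min x0|case: (Hf q)].
  move=> i j k l /andP[ij j5] /andP[kl l5] ijkl z w Kz Kw.
  have i5 := ltn_trans ij j5; have k5 := ltn_trans kl l5.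
  have [_ /(_ ij kl ijkl z w Kz Kw)] :=
    Hf ((Ordinal i5, Ordinal j5), (Ordinal k5, Ordinal l5)).
  apply: le_trans; rewrite ler_pM2l//.
  exact: bigmin_le_cond.
have /choice[s Hs] : forall q : nat * nat, exists s, (q.1 < q.2 < 5)%N ->
    [/\ chain d (P q.1) s, last (P q.1) s = P q.2 & {in P q.1 :: s, forall v, K q.1 q.2 v}].
  move=> [i j] /=; have [ij|nij] := boolP (i < j < 5)%N; last by exists [::].
  by have [_ cK Ki Kj] := HK _ _ ij; have [s Hs] := connected_chain d0 cK Ki Kj; exists s.
apply: (@K5_parity (fun k i j => winding (fun v => v - P k) (P i) (s (i, j)))
                   (fun i j => upper (P j - P i))).
  move=> i j ij; rewrite -(opprB (P j)) upperN// subr_eq0; apply/eqP => Pij.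
  (* Two vertices are distinct points because they are ends of two independent, hence disjoint,
     edges. *)
  have [a [b [c [e [/and3P[ab ce abce] iab jce]]]]] : exists a b c e,
      [/\ [&& a < b < 5, c < e < 5 & uniq [:: a; b; c; e]]%N,
          i \in [:: a; b] & j \in [:: c; e]].
    clear -ij; move: i j ij => [|[|[|[|[|i]]]]] [|[|[|[|[|j]]]]] //= ij;
    (by rewrite andbF in ij) || (by exists 0%N, 2%N, 1%N, 3%N) || (by exists 0%N, 1%N, 2%N, 3%N) ||
    (by exists 0%N, 1%N, 2%N, 4%N) || (by exists 0%N, 2%N, 1%N, 4%N) ||
    (by exists 0%N, 3%N, 1%N, 4%N).
  have [_ _ Ka Kb] := HK _ _ ab; have [_ _ Kc Ke] := HK _ _ ce.
  apply: (HD _ _ _ _ ab ce abce (P i)).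
    by move: iab; rewrite !inE => /orP[] /eqP ->.
  by rewrite -Pij; move: jce; rewrite !inE => /orP[] /eqP ->.
move=> i j k l ij kl ijkl.
have [cij lij sij] := Hs (i, j) ij; have [ckl lkl skl] := Hs (k, l) kl.
rewrite -[RHS](winding_pair d0 cij ckl _ lij lkl).
  by congr (_ (+) _); rewrite addbACA.
by move=> z w /sij /= Kz /skl Kw; apply: dK Kz Kw.
Qed.

End PlanarK5.

(** * Outerplanar drawings *)

Section Outerplanar.
Variable R : realType.
Local Notation plane := (R * R)%type.

Definition seg (x y : plane) : set plane :=
  (fun t : R => x + t *: (y - x)) @` `[0, 1].

Lemma seg_continuous (x y : plane) : continuous (fun t : R => x + t *: (y - x)).
Proof.
move=> t; apply: cvgD; first exact: cvg_cst.
by apply: cvgZr_tmp; exact: cvg_id.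
Qed.

Lemma seg_compact (x y : plane) : compact (seg x y).
Proof.
apply: continuous_compact; last exact: segment_compact.
exact/continuous_subspaceT/seg_continuous.
Qed.

Lemma seg_connected (x y : plane) : connected (seg x y).
Proof.
apply: connected_continuous_connected; first exact: segment_connected.
exact/continuous_subspaceT/seg_continuous.
Qed.

Lemma seg_start (x y : plane) : seg x y x.
Proof. by exists 0; rewrite ?scale0r ?addr0 //= in_itv/= lexx ler01. Qed.

Lemma seg_end (x y : plane) : seg x y y.
Proof. by exists 1; rewrite ?scale1r ?subrKC //= in_itv/= lexx ler01. Qed.

Lemma seg_ball (x y : plane) r : ball x r y -> seg x y `<=` ball x r.
Proof.
rewrite -ball_normE /= => xy _ [t /= + <-]; rewrite in_itv /= => /andP[t0 t1].
rewrite opprD addNKr normrN normrZ ger0_norm// distrC.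
by apply: le_lt_trans xy; rewrite ler_piMl.
Qed.

Lemma component_segment (A : set plane) (z x y : plane) r :
  connected_component A z x -> ball x r `<=` A -> ball x r y ->
  seg x y `<=` connected_component A z.
Proof.
move=> zx xA xy; rewrite (same_connected_component zx).
apply: connected_component_max; first exact: seg_start.
  exact: subset_trans (seg_ball xy) xA.
exact: seg_connected.
Qed.

(** Points in a common ball inside [A] are joined by a segment, and continua sharing a point have a
    continuum as union. *)
Lemma component_continuum (A : set plane) (z x y : plane) : open A ->
  connected_component A z x -> connected_component A z y ->
  exists C, [/\ compact C, connected C, C x, C y & C `<=` connected_component A z].
Proof.
move=> oA zx zy.
pose E x y := exists C, [/\ compact C, connected C, C x, C y &
  C `<=` connected_component A z].
apply: (connected_locally (E := E) (@component_connected _ A z)) zx zy.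
- move=> v Fv; exists [set v]; split=> //; [exact: compact_set1|exact: connected1|].
  by move=> _ ->.
- by move=> v w [C [? ? ? ? ?]]; exists C; split.
- move=> u v w [C [c1 c2 Cu Cv CF]] [D [d1 d2 Dv Dw DF]]; exists (C `|` D); split.
  + exact: compactU.
  + by apply: connectedU => //; exists v.
  + by left.
  + by right.
  + by rewrite subUset.
- move=> v Fv; have Av := connected_component_sub Fv.
  have /nbhs_ballP[r /= r0 rA] : nbhs v A by exact: open_nbhs_nbhs.
  exists (ball v r); split; [exact: ball_open|exact: ballxx|].
  move=> w Fw vw; exists (seg v w); split.
  + exact: seg_compact.
  + exact: seg_connected.
  + exact: seg_start.
  + exact: seg_end.
  + exact: component_segment Fv rA vw.
Qed.

Section Drawing.
Variables (G : sgraph) (p : G -> plane) (ar : G -> G -> set plane).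
Hypothesis drawing : is_plane_drawing p ar.

Lemma arc_continuum u v : adj u v ->
  [/\ compact (ar u v), connected (ar u v), ar u v (p u) & ar u v (p v)].
Proof.
case: drawing => _ H _ _ /H[_ [g [cg _ <- <- <-]]]; split.
- by apply: continuous_compact => //; exact: segment_compact.
- by apply: connected_continuous_connected => //; exact: segment_connected.
- by exists 0 => //=; rewrite in_itv/= lexx ler01.
- by exists 1 => //=; rewrite in_itv/= lexx ler01.
Qed.

Fixpoint path_region (a : G) (s : seq G) : set plane :=
  if s is b :: s' then ar a b `|` path_region b s' else [set p a].

Lemma path_region_mem a s v : path (@adj G) a s -> v \in a :: s -> path_region a s (p v).
Proof.
elim: s a => [|b s IH] a /=; first by move=> _; rewrite inE => /eqP ->.
move=> /andP[ab bs]; rewrite inE => /orP[/eqP ->|vs]; last by right; exact: IH.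
by left; have [] := arc_continuum ab.
Qed.

Lemma path_region_compact a s : path (@adj G) a s -> compact (path_region a s).
Proof.
elim: s a => [|b s IH] a /=; first by move=> _; exact: compact_set1.
move=> /andP[/arc_continuum[ab _ _ _] bs]; apply: compactU => //; exact: IH.
Qed.

Lemma path_region_connected a s : path (@adj G) a s -> connected (path_region a s).
Proof.
elim: s a => [|b s IH] a /=; first by move=> _; exact: connected1.
move=> /andP[/arc_continuum[_ ab _ pb] bs]; apply: connectedU => //; last exact: IH.
by exists (p b); split => //; apply: path_region_mem => //; rewrite mem_head.
Qed.

Lemma path_regionP a s z : path (@adj G) a s -> path_region a s z ->
  (exists2 v, v \in a :: s & z = p v) \/
  exists u v, [/\ u \in a :: s, v \in a :: s, adj u v & ar u v z].
Proof.
elim: s a => [|b s IH] a /=; first by move=> _ ->; left; exists a; rewrite ?mem_head.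
move=> /andP[ab bs] [abz|/(IH b bs)[[v vs ->]|[u [v [us vs uv uvz]]]]].
- by right; exists a, b; rewrite !inE !eqxx orbT.
- by left; exists v => //; rewrite inE vs orbT.
- by right; exists u, v; split => //; rewrite inE ?us ?vs orbT.
Qed.

Lemma path_region_support a s : path (@adj G) a s ->
  path_region a s `<=` drawing_support p ar.
Proof.
move=> as_ z /(path_regionP as_)[[v _ ->]|[u [v [_ _ uv uvz]]]].
  by left; exists v.
by right; exists u, v.
Qed.

Lemma path_region_vertex a s v : path (@adj G) a s -> path_region a s (p v) -> v \in a :: s.
Proof.
case: drawing => pI _ H _ as_ /(path_regionP as_)[[w ws /pI ->//]|].
by move=> [u [w [us ws uw /(H _ _ _ uw)]]] => -[] ->.
Qed.

Lemma path_region_disjoint a s b t z : path (@adj G) a s -> path (@adj G) b t ->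
  ~~ has (mem (a :: s)) (b :: t) -> path_region a s z -> path_region b t z -> False.
Proof.
move=> as_ bt /hasPn dis asz btz.
suff [v zv] : exists v, z = p v.
  rewrite zv in asz btz.
  by move/negP: (dis v (path_region_vertex bt btz)); apply; exact: path_region_vertex asz.
case: drawing => pI _ H Hx.
have [[v _ ->]|[u [v [us vs uv uvz]]]] := path_regionP as_ asz; first by exists v.
have [[w _ ->]|[x [y [xt yt xy xyz]]]] := path_regionP bt btz; first by exists w.
have [] // := Hx u v x y uv xy _ z; last by move=> w _ <-; exists w.
move=> [[xu _]|[xv _]]; move/negP: (dis _ xt); apply.
  by rewrite xu.
by rewrite xv.
Qed.

Lemma drawing_support_closed : closed (drawing_support p ar).
Proof.
rewrite (_ : drawing_support p ar =
  \bigcup_(v in [set: G]) [set p v] `|`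
  \bigcup_(q in [set q : G * G | adj q.1 q.2]) ar q.1 q.2).
  apply: closedU; apply: closed_bigcup => [|q Hq]; try exact: finite_finset.
    by apply: compact_closed; [exact: norm_hausdorff|exact: compact_set1].
  apply: compact_closed; first exact: norm_hausdorff.
  by have [] := arc_continuum Hq.
apply/seteqP; split => z.
  by move=> [[v _ <-]|[u [v [uv uvz]]]]; [left; exists v|right; exists (u, v)].
by move=> [[v _ ->]|[[u v] uv uvz]]; [left; exists v|right; exists u, v].
Qed.

(** A continuum in the face comes close to [p v], and a segment completes it. The segment may cross
    the drawing, but it stays in a ball that misses [L]. *)
Lemma apex_continuum (z0 z : plane) (v : G) (L : set plane) :
  closed L -> ~ L (p v) -> L `<=` drawing_support p ar ->
  connected_component (~` drawing_support p ar) z0 z ->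
  closure (connected_component (~` drawing_support p ar) z0) (p v) ->
  exists C, [/\ compact C, connected C, C z, C (p v) & forall x, C x -> L x -> False].
Proof.
move=> cL Lv Lsub Fz clv.
have oD : open (~` drawing_support p ar).
  exact/closed_openC/drawing_support_closed.
have /nbhs_ballP[r /= r0 rL] : nbhs (p v) (~` L).
  by apply: open_nbhs_nbhs; split => //; exact: closed_openC.
have [y [Fy vy]] := clv _ (nbhsx_ballx (p v) r r0).
have [C [c1 c2 Cz Cy CF]] := component_continuum oD Fz Fy.
exists (C `|` seg (p v) y); split.
- by apply: compactU => //; exact: seg_compact.
- apply: connectedU => //; last exact: seg_connected.
  by exists y; split => //; exact: seg_end.
- by left.
- by right; exact: seg_start.
- move=> x [/CF/connected_component_sub Dx /Lsub //|].
  by move=> /(seg_ball vy)/rL.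
Qed.

End Drawing.

(* An apex [z0] in the outer face, joined to [a], [b], [c] and [d], completes a
   drawing of [K_5]. *)
Lemma outerplanar_crossfree (G : sgraph) : outerplanar R G -> crossfree (@adj G).
Proof.
move=> [p [ar [F [D [[z0 Dz0 ->] _] cl]]]] a b c d.
move=> [ab [cd [pab lab pcd lcd dab]]] [ac [bd [pac lac pbd lbd dac]]].
move=> [ad [bc [pad lad pbc lbc dad]]].
set A := ~` _ in Dz0 cl.
have Fz0 : connected_component A z0 z0 by exact: connected_component_refl.
have apex (v x y w : G) s t r : path (@adj G) x s -> path (@adj G) y t ->
    path (@adj G) w r -> v \notin x :: s -> v \notin y :: t -> v \notin w :: r ->
    exists C, [/\ compact C, connected C, C z0, C (p v) & forall z, C z ->
      [/\ ~ path_region p ar x s z, ~ path_region p ar y t z & ~ path_region p ar w r z]].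
  move=> xs yt wr vx vy vw.
  have [|||||C [c1 c2 Cz Cv CL]] := apex_continuum D (z0 := z0) (z := z0) (v := v)
    (L := path_region p ar x s `|` path_region p ar y t `|` path_region p ar w r) => //.
  - by do !apply: closedU; (apply: compact_closed; first exact: norm_hausdorff);
      exact: (path_region_compact D).
  - by move=> [[]|] /(path_region_vertex D); [move/(_ xs)|move/(_ yt)|move/(_ wr)];
      apply/negP.
  - by rewrite !subUset; split; [split|]; exact: path_region_support.
  - exists C; split => // z Cz'; split => H; apply: (CL z Cz').
    + by left; left.
    + by left; right.
    + by right.
have memh (x : G) s y : last x s = y -> (x \in x :: s) * (y \in x :: s).
  by move=> <-; rewrite mem_head mem_last.
have [aab bab] := memh _ _ _ lab; have [ccd dcd] := memh _ _ _ lcd.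
have [aac cac] := memh _ _ _ lac; have [bbd dbd] := memh _ _ _ lbd.
have [aad dad'] := memh _ _ _ lad; have [bbc cbc] := memh _ _ _ lbc.
have dis (x : G) s y t v : ~~ has (mem (x :: s)) (y :: t) ->
    (v \in x :: s -> v \notin y :: t) * (v \in y :: t -> v \notin x :: s).
  move=> /hasPn H; split => [vx|/H//]; apply/negP => /H; rewrite /= vx //.
pose q (i : nat) : plane := nth z0 [:: z0; p a; p b; p c; p d] i.
(* The apex edge to a vertex has to miss just the paths between the other three, none of which
   passes through that vertex. *)
have [Ka [ka1 ka2 ka3 ka4 ka5]] := apex a c b b cd bd bc pcd pbd pbc
  ((dis _ _ _ _ _ dab).1 aab) ((dis _ _ _ _ _ dac).1 aac) ((dis _ _ _ _ _ dad).1 aad).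
have [Kb [kb1 kb2 kb3 kb4 kb5]] := apex b c a a cd ac ad pcd pac pad
  ((dis _ _ _ _ _ dab).1 bab) ((dis _ _ _ _ _ dac).2 bbd) ((dis _ _ _ _ _ dad).2 bbc).
have [Kc [kc1 kc2 kc3 kc4 kc5]] := apex c a b a ab bd ad pab pbd pad
  ((dis _ _ _ _ _ dab).2 ccd) ((dis _ _ _ _ _ dac).1 cac) ((dis _ _ _ _ _ dad).2 cbc).
have [Kd [kd1 kd2 kd3 kd4 kd5]] := apex d a a b ab ac bc pab pac pbc
  ((dis _ _ _ _ _ dab).2 dcd) ((dis _ _ _ _ _ dac).2 dbd) ((dis _ _ _ _ _ dad).1 dad').
pose K (i j : nat) := nth set0 (nth [::] [::
  [:: set0; Ka; Kb; Kc; Kd];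
  [:: set0; set0; path_region p ar a ab; path_region p ar a ac; path_region p ar a ad];
  [:: set0; set0; set0; path_region p ar b bc; path_region p ar b bd];
  [:: set0; set0; set0; set0; path_region p ar c cd]] i) j.
have good x s y : path (@adj G) x s -> last x s = y ->
    [/\ compact (path_region p ar x s), connected (path_region p ar x s),
        path_region p ar x s (p x) & path_region p ar x s (p y)].
  move=> xs lxs; have [xx yx] := memh _ _ _ lxs.
  split; [exact: (path_region_compact D xs)|exact: (path_region_connected D xs)| |];
    exact: (path_region_mem D).
have Rd x s y t : path (@adj G) x s -> path (@adj G) y t -> ~~ has (mem (x :: s)) (y :: t) ->
    forall z, (path_region p ar x s z -> path_region p ar y t z -> False) *
              (path_region p ar y t z -> path_region p ar x s z -> False).
  move=> xs yt H z; split => [u v|v u]; exact: (path_region_disjoint D xs yt H u v).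
apply: (@K5_not_planar R q K).
  case=> [|[|[|[|[|i]]]]] [|[|[|[|[|j]]]]] //= ij;
    (by rewrite andbF in ij) || (by exact: good) || (by split).
have [da1 da2] := (Rd _ _ _ _ pab pcd dab, Rd _ _ _ _ pac pbd dac).
have da3 := Rd _ _ _ _ pad pbc dad.
move=> i j k l + + + z.
case: i j => [|[|[|[|[|i]]]]] [|[|[|[|[|j]]]]] //=; rewrite ?andbF //= => _;
case: k l => [|[|[|[|[|k]]]]] [|[|[|[|[|l]]]]] //=; rewrite ?andbF //= => _ _;
rewrite /K /=;
by [move=> /ka5[] | move=> /kb5[] | move=> /kc5[] | move=> /kd5[]
  | move=> + /ka5[] | move=> + /kb5[] | move=> + /kc5[] | move=> + /kd5[]
  | case: (da1 z) | case: (da2 z) | case: (da3 z)].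
Qed.
End Outerplanar.

(** * A straight-line drawing of the fan *)

Section FanDrawing.
Variable R : realType.
Local Notation plane := (R * R)%type.

Lemma segP (a b z : plane) : seg a b z ->
  exists t : R, [/\ 0 <= t <= 1, z.1 = a.1 + t * (b.1 - a.1) & z.2 = a.2 + t * (b.2 - a.2)].
Proof. by move=> [t /=]; rewrite in_itv /= => t01 <-; exists t. Qed.

Lemma segC (a b : plane) : seg a b = seg b a.
Proof.
suff H : forall a b : plane, seg a b `<=` seg b a by apply/seteqP; split; exact: H.
move=> x y _ [t + <-]; rewrite /= in_itv /= => /andP[t0 t1].
exists (1 - t); first by rewrite /= in_itv /=; lra.
by rewrite scalerBl scale1r addrA subrKC -scalerN opprB.
Qed.

Lemma seg_simple_arc (a b : plane) : a != b -> is_simple_arc (seg a b) a b.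
Proof.
move=> ab; exists (fun t => a + t *: (b - a)); split => //.
- exact/continuous_subspaceT/seg_continuous.
- move=> s t _ _ /addrI/eqP; rewrite -subr_eq0 -scalerBl scaler_eq0 subr_eq0 [_ - a == 0]subr_eq0.
  by rewrite (eq_sym b) (negPf ab) orbF => /eqP.
- by rewrite scale0r addr0.
- by rewrite scale1r subrKC.
Qed.

Lemma star_connected (A : set plane) c : (forall z, A z -> seg c z `<=` A) -> connected A.
Proof.
move=> cA; rewrite (_ : A = \bigcup_(z in A) seg c z).
  apply: bigcup_connected => [|z _]; last exact: seg_connected.
  by exists c => z _; exact: seg_start.
apply/seteqP; split => z; first by move=> Az; exists z => //; exact: seg_end.
by move=> [w /cA]; apply.
Qed.

Lemma seg_between (a b m t : R) : 0 <= t <= 1 -> m < a -> m < b -> m < a + t * (b - a).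
Proof.
move=> /andP[t0 t1] ma mb; have [ab|ba] := leP a b.
  by rewrite ltr_wpDr // mulr_ge0 // subr_ge0.
have : 0 <= (1 - t) * (a - b) by rewrite mulr_ge0 // subr_ge0 // ltW.
by move=> ?; lra.
Qed.

(** The complement of a half-strip that contains the fan: three half-planes, the middle one meeting
    the two others. *)
Lemma exterior_connected :
  connected [set z : plane | [\/ 1 < z.2, z.1 < 0 | z.2 < 0]].
Proof.
have -> : [set z : plane | [\/ 1 < z.2, z.1 < 0 | z.2 < 0]] =
    [set z | 1 < z.2] `|` [set z | z.1 < 0] `|` [set z | z.2 < 0].
  apply/seteqP; split => z /=.
    by move=> [?|?|?]; [left; left|left; right|right].
  by move=> [[?|?]|?]; [constructor 1|constructor 2|constructor 3].
have neg (a b t : R) : 0 <= t <= 1 -> a < 0 -> b < 0 -> a + t * (b - a) < 0.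
  move=> t01 a0 b0; rewrite -oppr_gt0 opprD -mulrN opprB.
  by rewrite (_ : a - b = - b - - a); [apply: seg_between; rewrite ?oppr_gt0|ring].
apply: connectedU.
- by exists (-1, -1); split => /=; [right|]; rewrite ltrN10.
- apply: connectedU.
  + by exists (-1, 2); split => /=; rewrite ?ltrN10 // ltr1n.
  + apply: (@star_connected _ (0, 2)) => z /= z2 w /segP[t [t01 _ E]]; rewrite /= E /=.
    by apply: seg_between; rewrite // ltr1n.
  + apply: (@star_connected _ (-1, 0)) => z /= z2 w /segP[t [t01 E _]]; rewrite /= E /=.
    by apply: neg; rewrite // ltrN10.
- apply: (@star_connected _ (0, -1)) => z /= z2 w /segP[t [t01 _ E]]; rewrite /= E /=.
  by apply: neg; rewrite // ltrN10.
Qed.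

Variables m n : nat.
Local Notation fan := (fan m n).

(** All vertices lie on the boundary of the half-strip, the hub at its lower corner and the rim on
    its upper side. *)
Definition fan_point (v : fan) : plane := if v is Some k then (k%:R, 1) else (0, 0).

Definition fan_arc (u v : fan) : set plane := seg (fan_point u) (fan_point v).

Lemma fan_point_inj : injective fan_point.
Proof.
move=> [i|] [j|] //= [].
- by move=> /eqP; rewrite eqr_nat => /eqP ij; congr Some; apply: val_inj.
- by move=> _ /eqP; rewrite oner_eq0.
- by move=> _ /eqP; rewrite eq_sym oner_eq0.
Qed.

Lemma fan_arcP (u v : fan) : adj u v ->
  (exists k, ((u = None /\ v = Some k) \/ (u = Some k /\ v = None)) /\
     forall z, fan_arc u v z -> z.1 = z.2 * k%:R /\ 0 <= z.2 <= 1) \/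
  (exists k l, [/\ ((u = Some k /\ v = Some l) \/ (u = Some l /\ v = Some k)),
     k.+1 = l & forall z, fan_arc u v z -> z.2 = 1 /\ k%:R <= z.1 <= k%:R + 1]).
Proof.
have spoke k z : fan_arc None (Some k) z -> z.1 = z.2 * k%:R /\ 0 <= z.2 <= 1.
  by move=> /segP[t [t01 -> ->]] /=; rewrite !add0r !subr0 mulr1.
have rim (k l : 'I_(3 * #|kinds m n|)) z :
    k.+1 = l -> fan_arc (Some k) (Some l) z -> z.2 = 1 /\ k%:R <= z.1 <= k%:R + 1.
  move=> kl /segP[t [t01 -> ->]] /=; rewrite -kl -natr1; split; first by ring.
  by rewrite (_ : _ - _ = 1); [rewrite mulr1; lra|ring].
case: u v => [i|] [j|] //=.
- move=> /orP[/eqP ij|/eqP ji]; right.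
    by exists i, j; split => //; [left|move=> z; exact: rim].
  exists j, i; split => //; [by right|move=> z].
  by rewrite /fan_arc segC; exact: rim.
- by move=> _; left; exists i; split; [right|move=> z; rewrite /fan_arc segC; exact: spoke].
- by move=> _; left; exists j; split; [left|move=> z; exact: spoke].
Qed.

Lemma fan_outerplanar : outerplanar R fan.
Proof.
pose D := drawing_support fan_point fan_arc.
have Dbox z : D z -> 0 <= z.1 /\ 0 <= z.2 <= 1.
  move=> [[[k|] _ <-]|[u [v [/fan_arcP[[k [_ H]]|[k [l [_ _ H]]]] /H]]]] /=.
  - by rewrite ler01 lexx ler0n.
  - by rewrite ler01 lexx.
  - by move=> [-> /andP[z0 z1]]; rewrite z0 z1; split => //; rewrite mulr_ge0.
  - move=> [-> /andP[kz _]]; rewrite ler01 lexx; split => //.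
    by apply: le_trans kz; rewrite ler0n.
have ext : [set z : plane | [\/ 1 < z.2, z.1 < 0 | z.2 < 0]] `<=` ~` D.
  by move=> z /= H /Dbox[z1 /andP[z2 z3]]; case: H; lra.
have z0ext : [set z : plane | [\/ 1 < z.2, z.1 < 0 | z.2 < 0]] (0, 2).
  by constructor; rewrite /= ltr1n.
pose F := connected_component (~` D) (0, 2).
have extF : [set z : plane | [\/ 1 < z.2, z.1 < 0 | z.2 < 0]] `<=` F.
  exact: connected_component_max z0ext ext exterior_connected.
exists fan_point, fan_arc, F; split; [split|split|].
- exact: fan_point_inj.
- move=> u v uv; split; first exact: segC.
  apply: seg_simple_arc; apply/eqP => /fan_point_inj E.
  by rewrite E adj_irrefl in uv.
- move=> u v w /fan_arcP[[k [uv H]]|[k [l [uv kl H]]]] /H.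
    case: w => [j|]; last by case: uv => -[-> ->]; auto.
    rewrite /= mul1r => -[/eqP + _]; rewrite eqr_nat => /eqP jk.
    have -> : j = k by apply: val_inj.
    by case: uv => -[-> ->]; auto.
  case: w => [j|]; last by move=> [/= /eqP]; rewrite eq_sym oner_eq0.
  rewrite /= natr1 !ler_nat => -[_ /andP[kj jk]].
  have E : j = k \/ j = l.
    have [E|E] := eqVneq (j : nat) k; first by left; apply: val_inj.
    by right; apply: val_inj; move/eqP: E; move: kl kj jk => /=; clear; lia.
  by case: E uv => -> [] [-> ->]; auto.
- move=> u v x y /fan_arcP[[k [uv H]]|[k [l [uv kl H]]]];
  move=> /fan_arcP[[k' [xy H']]|[k' [l' [xy kl' H']]]] ne z [/H [z1 z2] /H' [z1' z2']].
  (* Two spokes have different slopes and meet only at the hub; a spoke meets height 1 only at its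
     rim end; two rim edges share at most an integer point. *)
  + have kk : k != k'.
      apply/eqP => kk; apply: ne; rewrite kk in uv.
      by case: uv xy => -[-> ->] [] [-> ->]; auto.
    have z20 : z.2 = 0.
      move: z1'; rewrite z1 => /eqP; rewrite -subr_eq0 -mulrBr mulf_eq0 subr_eq0 eqr_nat.
      by move=> /orP[/eqP//|/eqP kk']; rewrite (val_inj kk') eqxx in kk.
    by exists None => //=; rewrite [z]surjective_pairing z1 z20 mul0r.
  + exists (Some k) => //=.
    by rewrite [z]surjective_pairing z1 z1' mul1r.
  + exists (Some k') => //=.
    by rewrite [z]surjective_pairing z1' z1 mul1r.
  + have kk : k != k'.
      apply/eqP => kk; apply: ne; have ll : l = l' by apply: val_inj; rewrite /= -kl -kl' kk.
      by rewrite kk ll in uv; case: uv xy => -[-> ->] [] [-> ->]; auto.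
    move/andP: z2 => [a1 a2]; move/andP: z2' => [b1 b2].
    have := neq_ltn k k'; rewrite -(inj_eq val_inj) in kk; rewrite kk => /esym/orP[lt|lt].
    * exists (Some k') => //=; rewrite [z]surjective_pairing z1; congr (_, _).
      have : (k.+1)%:R <= k'%:R :> R by rewrite ler_nat.
      by rewrite -natr1 => ?; lra.
    * exists (Some k) => //=; rewrite [z]surjective_pairing z1; congr (_, _).
      have : (k'.+1)%:R <= k%:R :> R by rewrite ler_nat.
      by rewrite -natr1 => ?; lra.
- by exists (0, 2) => //; exact: ext.
- move=> [M [_ HM]].
  have := HM (`|M| + 1); rewrite (le_lt_trans (ler_norm M)) ?ltrDl // => /(_ isT).
  move=> /(_ (0, `|M| + 2)) /= /(_ _)/wrap[].
    by apply: extF; constructor; have := normr_ge0 M; rewrite /=; lra.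
  rewrite leNgt => /negP; apply; apply: (@lt_le_trans _ _ (`|M| + 2)); first by lra.
  by rewrite norm_pair_ge /= ler_norm orbT.
- move=> v B /nbhs_ballP[r /= r0 rB].
  case: v rB => [k|] rB.
  + exists (k%:R, 1 + r / 2); split; first by apply: extF; constructor; rewrite /= ltrDl divr_gt0.
    apply: rB; rewrite -ball_normE /= norm_pair_lt /= subrr normr0 r0 opprD addrA subrr sub0r normrN.
    by rewrite gtr0_norm ?divr_gt0 // ltr_pdivrMr // ltr_pMr // ltr1n.
  + exists (0, - (r / 2)); split; first by apply: extF; constructor 3; rewrite /= oppr_lt0 divr_gt0.
    apply: rB; rewrite -ball_normE /= norm_pair_lt /= subrr normr0 r0 sub0r opprK.
    by rewrite gtr0_norm ?divr_gt0 // ltr_pdivrMr // ltr_pMr // ltr1n.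
Qed.

End FanDrawing.

Local Close Scope classical_set_scope.

Lemma special_omega (m n : nat) (V : finType) (G : cmgraph m n V) :
  (forall u v, u != v -> special G u v) -> omega_a G = #|V| /\ omega_r G = #|V|.
Proof.
move=> sp; split; apply: nat_max_eq.
- have [H HE] := restrict [in [set: V]%SET] G.
  exists [set: V]%SET, H; split; last by rewrite cardsT.
    by apply/is_homP => k u v; rewrite HE.
  apply: special_clique => u v uv.
  have [|[w [k [k' [wu wv kk]]]]] := sp (val u) (val v) uv.
    rewrite !underlying_adjE => /existsP[k h]; left; rewrite underlying_adjE.
    by apply/existsP; exists k; rewrite HE.
  by right; exists (exist _ w (finset.in_setT w)), k, k'; rewrite !HE.
- by move=> _ [S [H [_ _ <-]]]; exact: max_card.
- exists [set: V]%SET; split; last by rewrite cardsT.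
  move=> W H f fh u v _ _ fuv; apply/eqP; apply: contrapT => /negP /sp.
  by move=> /(special_separated fh); rewrite fuv eqxx.
- by move=> _ [S [_ <-]]; exact: max_card.
Qed.

Theorem theorem2 (R : realType) (m n : nat) (hmn : (m, n) <> (0, 1)%N) :
  family_omega_a m n (outerplanar R) = (3 * (2 * m + n) + 1)%N /\
  family_omega_r m n (outerplanar R) = (3 * (2 * m + n) + 1)%N.
Proof.
have ub (G : sgraph) (H : cmgraph m n G) : outerplanar R G -> underlying_adj H =2 @adj G ->
    (omega_a H <= 3 * (2 * m + n) + 1)%N /\ (omega_r H <= 3 * (2 * m + n) + 1)%N.
  move=> /outerplanar_crossfree cross HG; split; apply: nat_max_le => k.
    move=> [S [H' [sub cl <-]]].
    exact: (relative_clique_bound hmn HG cross (clique_relative sub cl)).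
  by move=> [S [cl <-]]; exact: (relative_clique_bound hmn HG cross cl).
have [H [HG sp]] := fan_coloring hmn.
have [Ha Hr] := special_omega sp.
have Fout := @fan_outerplanar R m n.
split; apply: nat_max_eq.
- exists (fan m n); split => //; rewrite -card_fan; apply: nat_max_eq.
    by exists H.
  by move=> _ [H' [H'G <-]]; rewrite card_fan; have [] := ub _ H' Fout H'G.
- by move=> _ [G [Gout <-]]; apply: nat_max_le => _ [H' [H'G <-]]; have [] := ub _ H' Gout H'G.
- exists (fan m n); split => //; rewrite -card_fan; apply: nat_max_eq.
    by exists H.
  by move=> _ [H' [H'G <-]]; rewrite card_fan; have [] := ub _ H' Fout H'G.
- by move=> _ [G [Gout <-]]; apply: nat_max_le => _ [H' [H'G <-]]; have [] := ub _ H' Gout H'G.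
Qed.
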